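(* Let $q=q(t)=e^{-t}$ and $P=q^{H}=e^{-tH}$ for $t>0$. For $0<|Q|<1$ with $Q\notin(-\infty,0]$, $$\lim_{t\to0^+}P^{\ell_q(Q)}\sum_{d=0}^\infty\frac{\prod_{i=1}^4(Pq^{\frac i5};q)_d}{(Pq;q)_d^4}Q^d=Q^H\sum_{d=0}^\infty\frac{\prod_{i=1}^4\big(H+\frac i5\big)_d}{(H+1)_d^4}Q^d\mod(H^4).$$
   Context: Everything takes place in $\mathbb{C}[H]/(H^4)$: both sides are expanded as polynomials in $H$ modulo $H^4$ and the limit is taken coefficientwise. $q^{i/5}=e^{-ti/5}$. $(a;q)_d=\prod_{k=0}^{d-1}(1-aq^k)$, and without $q$, $(x)_d=\prod_{k=0}^{d-1}(x+k)$. $\theta_q(Q)=\sum_{d\in\mathbb{Z}}q^{d(d-1)/2}Q^d$; $\ell_q(Q)=-Q\theta_q'(Q)/\theta_q(Q)$; $P^{\ell_q(Q)}:=\sum_{a\ge0}(-1)^a\binom{\ell_q(Q)}{a}(1-P)^a$ with $\binom{\ell}{a}=\frac1{a!}\prod_{r=0}^{a-1}(\ell-r)$ (a finite sum modulo $H^4$, since $1-P$ is divisible by $H$). $Q^H=e^{H\log Q}$ with the principal branch of the logarithm. *)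

(* Defs.v *)
From HB Require Import structures.
From mathcomp Require Import all_boot all_order all_algebra.
From mathcomp Require Import all_classical all_reals all_analysis.
From mathcomp Require Import complex qpoly.

Set Implicit Arguments.
Unset Strict Implicit.
Unset Printing Implicit Defensive.

Import Order.TTheory GRing.Theory Num.Theory.
Import numFieldNormedType.Exports.

Local Open Scope ring_scope.
Local Open Scope classical_set_scope.

(* The topology and norm that every numFieldType carries through its regular
   module, made available on the concrete type R[i]. *)
HB.instance Definition _ (R : rcfType) := GRing.ComAlgebra.copy R[i] R[i]^o.
HB.instance Definition _ (R : rcfType) := Vector.copy R[i] R[i]^o.
HB.instance Definition _ (R : rcfType) := NormedModule.copy R[i] R[i]^o.

(* Named, so that rewriting with power identities does not reach inside the
   type {poly %/ X4 R}. *)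
Definition X4 (R : realType) : {poly R[i]} := 'X^4.

(* C[H]/(H^4); for x : truncH R, x`_k is the coefficient of H^k of the
   representative of degree < 4. *)
Notation truncH R := {poly %/ (X4 R)}.

Definition H {R : realType} : truncH R := in_qpoly (X4 R) 'X.

(* {poly %/ p} silently replaces p by 'X unless p is monic of positive degree;
   this rules the replacement out. *)
Lemma mk_monic_X4 (R : realType) : mk_monic (X4 R) = 'X^4.
Proof. by rewrite /mk_monic /X4 size_polyXn monicXn. Qed.

Lemma H4_eq0 (R : realType) : (H : truncH R) ^+ 4 = 0.
Proof.
rewrite /H -rmorphXn; apply/val_inj.
change (Pdiv.CommonRing.rmodp ('X ^+ 4) (mk_monic (X4 R)) = 0 :> {poly R[i]}).
by rewrite mk_monic_X4 Pdiv.RingMonic.rmodpp // monicXn.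
Qed.

Section Truncated.
Variable R : realType.

(* Coefficientwise sum of an infinite series. *)
Definition hsum (u : nat -> truncH R) : truncH R :=
  in_qpoly (X4 R) (\poly_(k < 4) limn (series (fun d => (u d)`_k))).

(* e^{cH}; the terms of order >= 4 vanish by H4_eq0. *)
Definition expH (c : R[i]) : truncH R :=
  \sum_(k < 4) (c ^+ k / k`!%:R) *: H ^+ k.

Definition binomc (l : R[i]) (a : nat) : R[i] :=
  a`!%:R^-1 * \prod_(r < a) (l - r%:R).

(* P^l = \sum_(a >= 0) (-1)^a binom(l, a) (1 - P)^a, for P with 1 - P divisible
   by H, so that the terms with a >= 4 vanish. *)
Definition powH (P : truncH R) (l : R[i]) : truncH R :=
  \sum_(a < 4) ((-1) ^+ a * binomc l a) *: (1 - P) ^+ a.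

(* (a; q)_d *)
Definition qpoch (a : truncH R) (q : R[i]) (d : nat) : truncH R :=
  \prod_(k < d) (1 - q ^+ k *: a).

(* (x)_d *)
Definition poch (x : truncH R) (d : nat) : truncH R :=
  \prod_(k < d) (x + k%:R).

Definition zsum (u : int -> R[i]) : R[i] :=
  limn (series (fun n => u (Posz n))) + limn (series (fun n => u (Negz n))).

Definition theta (q Q : R[i]) : R[i] :=
  zsum (fun d : int => q ^ ((d * (d - 1))%R %/ 2)%Z * Q ^ d).

(* The derivative is the complex one. *)
Definition ell (q Q : R[i]) : R[i] :=
  - Q * derive1 (theta q) Q / theta q Q.

Definition Arg (z : R[i]) : R :=
  let phi := acos (complex.Re z / complex.Re `|z|) in
  if 0 <= complex.Im z then phi else - phi.

(* Principal branch, for z != 0: the imaginary part lies in ]-pi, pi]. *)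
Definition Log (z : R[i]) : R[i] := (ln (complex.Re `|z|) +i* Arg z)%C.

(* q^x = e^{-tx} for q = e^{-t} *)
Definition qpow (t x : R) : R[i] := (expR (- (t * x)))%:C%C.

(* P = q^H = e^{-tH} *)
Definition qH (t : R) : truncH R := expH (- t)%:C%C.

End Truncated.

(* Main.v *)
Require Import Defs.
From HB Require Import structures.
From mathcomp Require Import all_boot all_order all_algebra.
From mathcomp Require Import all_classical all_reals all_analysis.
From mathcomp Require Import complex qpoly ring lra.

Set Implicit Arguments.
Unset Strict Implicit.
Unset Printing Implicit Defensive.

Import Order.TTheory GRing.Theory Num.Theory.
Import numFieldNormedType.Exports.

Local Open Scope ring_scope.
Local Open Scope classical_set_scope.

(**
  The identity is a product of two limits in C[H]/(H^4), both taken coefficient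
  by coefficient.

  The hypergeometric series. Each factor of a q-Pochhammer symbol is
  1 - e^{-t (x + H)}, which is t (x + H) to first order, so the terms of the
  q-series converge to those of the limit series: numerator and denominator have
  the same number of factors and the powers of t cancel (cvg_qfactor). To exchange
  limit and sum, write the factor as (1 - q^x)(1 - u) with u nilpotent; the
  ratios of the scalars 1 - q^x are at most 1, and u has norm at most 2/x
  uniformly in t (norm_qnil). Hence the ratios of consecutive terms are bounded,
  uniformly in t, by a sequence converging to |Q| < 1, and Tannery's theorem
  applies (cvg_hypergeometric).

  The power of P. As 1 - P is t H to first order, P^l tends to e^{L H} as soon as
  - t l tends to L (cvg_powH_qH). So everything reduces to the limit
  - t ell_q(Q) -> Log Q (cvg_ell), which is where theta enters.

  The limit of ell. Formally, the Jacobi triple product gives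
  - ell_q(Q) = Q theta'/theta
    = sum_{k >= 0} Q q^k / (1 + Q q^k) - sum_{k >= 1} 1 / (1 + Q q^{-k}).
  Only a finite form of it is used: Rothe's q-binomial theorem, recentred
  (jacobi_product), says that a truncation of theta with Gaussian binomial weights
  equals a finite product, and applying Q d/dQ identifies the ratio of the
  truncations of Q theta' and theta with a finite sum (jacobi_log_deriv). Letting
  the truncation grow gives the displayed formula as a limit, and the
  nonvanishing of theta (cvg_log_deriv_theta). Multiplied by t, the finite sum is
  a Riemann sum with step t of the function e^{-s} Q / (1 + e^{-s} Q) of s,
  whose primitive is - Log (1 + e^{-s} Q), the path staying in the slit plane
  because Q is not in (-oo, 0]. The error of the Riemann sum is O(t), uniformly in
  its length (Log_riemann_sum), since the variation of the integrand is controlled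
  by that of the bounded function 1 / (1 + e^{-s}). The increment of the primitive
  over [- t N, t N], minus t N, tends to Log Q when N tends to infinity, whence
  |Log Q + t ell_q(Q)| = O(t) (ell_bound).
*)

(** * The real-valued modulus on the complex numbers *)

Section ComplexModulus.
Variable R : realType.
Local Notation C := R[i].
Local Notation cabs := (@Normc.normc R).
Implicit Types z w : C.

Lemma normCE z : `|z| = (cabs z)%:C%C. Proof. by []. Qed.

Lemma cabs_ge0 z : 0 <= cabs z.
Proof. by case: z => a b; exact: sqrtr_ge0. Qed.

Lemma cabs_eq0 z : (cabs z == 0) = (z == 0).
Proof.
by apply/eqP/eqP => [/Normc.eq0_normc//|->]; rewrite Normc.normc0.
Qed.

Lemma cabs_gt0 z : (0 < cabs z) = (z != 0).
Proof. by rewrite lt_neqAle cabs_ge0 andbT eq_sym cabs_eq0. Qed.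

Lemma cabs_real (x : R) : cabs x%:C%C = `|x|.
Proof. by rewrite /= expr0n addr0 sqrtr_sqr. Qed.

Lemma cabsN z : cabs (- z) = cabs z. Proof. exact: normcN. Qed.

Lemma cabsD z w : cabs (z + w) <= cabs z + cabs w.
Proof. exact: le_normcD. Qed.

Lemma cabsB z w : cabs (z - w) = cabs (w - z).
Proof. by rewrite -cabsN opprB. Qed.

Lemma cabs_triangle z w v : cabs (z - v) <= cabs (z - w) + cabs (w - v).
Proof. by rewrite -[z - v](subrKA w) cabsD. Qed.

Lemma cabsX z n : cabs (z ^+ n) = cabs z ^+ n.
Proof.
by elim: n => [|n IH]; rewrite ?expr0 ?Normc.normc1 // !exprS Normc.normcM IH.
Qed.

Lemma cabs_sum (I : Type) (s : seq I) (P : pred I) (f : I -> C) :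
  cabs (\sum_(i <- s | P i) f i) <= \sum_(i <- s | P i) cabs (f i).
Proof.
elim/big_rec2: _ => [|i x y _ le_yx]; first by rewrite Normc.normc0.
by apply: le_trans (cabsD _ _) _; rewrite lerD2l.
Qed.

Lemma cabs_prod (I : Type) (s : seq I) (P : pred I) (f : I -> C) :
  cabs (\prod_(i <- s | P i) f i) = \prod_(i <- s | P i) cabs (f i).
Proof.
by elim/big_rec2: _ => [|i x y _ <-]; rewrite ?Normc.normc1 // Normc.normcM.
Qed.

Lemma cabs_Re z : `|complex.Re z| <= cabs z.
Proof.
by case: z => a b /=; rewrite -sqrtr_sqr ler_wsqrtr // lerDl sqr_ge0.
Qed.

Lemma cabs_Im z : `|complex.Im z| <= cabs z.
Proof.
by case: z => a b /=; rewrite -sqrtr_sqr ler_wsqrtr // lerDr sqr_ge0.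
Qed.

Lemma cabs_le_ReIm z : cabs z <= `|complex.Re z| + `|complex.Im z|.
Proof.
case: z => a b /=; rewrite -(@ger0_norm _ (`|a| + `|b|)) ?addr_ge0 //.
rewrite -sqrtr_sqr ler_wsqrtr // sqrrD !real_normK ?num_real //.
by rewrite -addrA [_ *+ 2 + _]addrC addrA lerDl mulrn_wge0 // mulr_ge0.
Qed.

Lemma cabs_dist z w : `|cabs z - cabs w| <= cabs (z - w).
Proof.
by have := lerB_dist z w; have := lerB_dist w z; rewrite !normCE -!rmorphB !lecR
  [cabs (w - z)]cabsB ler_norml lerNl opprB => -> ->.
Qed.

Lemma complex_subE z w :
  (complex.Re (z - w) = complex.Re z - complex.Re w) *
  (complex.Im (z - w) = complex.Im z - complex.Im w).
Proof. by case: z => a b; case: w. Qed.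

Lemma Re_realM (x : R) z : complex.Re (x%:C%C * z) = x * complex.Re z.
Proof. by case: z => u v /=; rewrite mul0r subr0. Qed.

Lemma Im_realM (x : R) z : complex.Im (x%:C%C * z) = x * complex.Im z.
Proof. by case: z => u v /=; rewrite mul0r addr0. Qed.

Section Cvg.
Context {T : Type} {F : set_system T}.
Context {FF : Filter F}.
Implicit Type f : T -> C.

(** The norm of R[i] takes its values in R[i], whose order is partial; going
    through the real modulus makes real inequalities usable. *)
Lemma cvgC_cabs f (l : C) :
  f x @[x --> F] --> l <-> (forall e : R, 0 < e ->
    \forall x \near F, cabs (l - f x) < e).
Proof.
split=> [/cvgrPdist_lt + e e0 | fl].
  move=> /(_ e%:C%C); rewrite ltcR => /(_ e0) h; apply: filterS h => x;
    by rewrite normCE ltcR.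
apply/cvgrPdist_lt => -[e e'] /[dup]; rewrite {1}ltcE /= => /andP[/eqP -> e0] _.
by apply: filterS (fl _ e0) => x; rewrite normCE -ltcR.
Qed.

Lemma cvgC_bound f (l : C) (g : T -> R) :
  (\forall x \near F, cabs (l - f x) <= g x) -> g x @[x --> F] --> (0 : R) ->
  f x @[x --> F] --> l.
Proof.
move=> fg /cvgrPdist_lt g0; apply/cvgC_cabs => e /g0.
apply: filterS2 fg => x le_g; rewrite sub0r normrN => /(le_lt_trans (ler_norm _)).
exact: le_lt_trans.
Qed.

Lemma cvg_cabs f (l : C) :
  f x @[x --> F] --> l -> cabs (f x) @[x --> F] --> cabs l.
Proof.
move=> /cvgC_cabs fl; apply/cvgrPdist_lt => e /fl.
by apply: filterS => x; apply: le_lt_trans; exact: cabs_dist.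
Qed.

Lemma cvg_complex f (l : C) :
  complex.Re (f x) @[x --> F] --> complex.Re l ->
  complex.Im (f x) @[x --> F] --> complex.Im l ->
  f x @[x --> F] --> l.
Proof.
move=> /cvgrPdist_lt re /cvgrPdist_lt im; apply/cvgC_cabs => e e0.
have e2 : 0 < e / 2 by rewrite divr_gt0.
apply: filterS2 (re _ e2) (im _ e2) => x rex imx.
apply: le_lt_trans (cabs_le_ReIm _) _.
by rewrite !complex_subE [e]splitr ltrD.
Qed.

Lemma cvg_Re f (l : C) :
  f x @[x --> F] --> l -> complex.Re (f x) @[x --> F] --> complex.Re l.
Proof.
move=> /cvgC_cabs fl; apply/cvgrPdist_lt => e /fl.
by apply: filterS => x; apply: le_lt_trans; rewrite -complex_subE cabs_Re.
Qed.

Lemma cvg_Im f (l : C) :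
  f x @[x --> F] --> l -> complex.Im (f x) @[x --> F] --> complex.Im l.
Proof.
move=> /cvgC_cabs fl; apply/cvgrPdist_lt => e /fl.
by apply: filterS => x; apply: le_lt_trans; rewrite -complex_subE cabs_Im.
Qed.

Lemma cvg_real_complex (f : T -> R) (l : R) :
  f x @[x --> F] --> l -> (f x)%:C%C @[x --> F] --> l%:C%C.
Proof. by move=> fl; apply: cvg_complex => //=; exact: cvg_cst. Qed.

End Cvg.
End ComplexModulus.

Section Limits.
Context {T : Type} {F : set_system T}.

Lemma cvg_le_const (R : realType) {FF : ProperFilter F} (f : T -> R) (l b : R) :
  f x @[x --> F] --> l -> (\forall x \near F, f x <= b) -> l <= b.
Proof.
move=> fl fb; rewrite leNgt; apply/negP => /(cvgr_gt _ fl) bf.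
by have [x []] := filter_ex (filterI fb bf); rewrite leNgt => /negP.
Qed.

Lemma cvg_sumr (K : numFieldType) (I : Type) (s : seq I) (P : pred I)
    {FF : Filter F} (f : I -> T -> K) (l : I -> K) :
  (forall i, P i -> f i x @[x --> F] --> l i) ->
  \sum_(i <- s | P i) f i x @[x --> F] --> \sum_(i <- s | P i) l i.
Proof.
move=> fl; elim: s => [|i s IH].
  by rewrite big_nil; under eq_fun do rewrite big_nil; exact: cvg_cst.
rewrite big_cons; under eq_fun do rewrite big_cons.
by case: ifP => // Pi; apply: cvgD; [exact: fl|exact: IH].
Qed.

Lemma cvg_exprn (K : numFieldType) {FF : Filter F} (f : T -> K) (l : K) n :
  f x @[x --> F] --> l -> f x ^+ n @[x --> F] --> l ^+ n.
Proof.
move=> fl; elim: n => [|n IH]; first exact: cvg_cst.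
by rewrite exprS; under eq_fun do rewrite exprS; apply: cvgM; [exact: fl|exact: IH].
Qed.

Lemma cvg_prodr (K : numFieldType) (I : Type) (s : seq I) (P : pred I)
    {FF : Filter F} (f : I -> T -> K) (l : I -> K) :
  (forall i, P i -> f i x @[x --> F] --> l i) ->
  \prod_(i <- s | P i) f i x @[x --> F] --> \prod_(i <- s | P i) l i.
Proof.
move=> fl; elim: s => [|i s IH].
  by rewrite big_nil; under eq_fun do rewrite big_nil; exact: cvg_cst.
rewrite big_cons; under eq_fun do rewrite big_cons.
by case: ifP => // Pi; apply: cvgM; [exact: fl|exact: IH].
Qed.

End Limits.

(** * Dominated series *)

Section DominatedSeries.
Variable R : realType.
Local Notation C := R[i].
Local Notation cabs := (@Normc.normc R).

Lemma ratio_test (b r : nat -> R) (l : R) :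
  (forall n, 0 <= b n) -> (forall n, b n.+1 <= r n * b n) ->
  r n @[n --> \oo] --> l -> l < 1 -> cvgn (series b).
Proof.
move=> b0 br rl l1.
(* The maximum keeps s positive, so that one may divide by its powers. *)
pose s := (Num.max l 0 + 1) / 2.
have ml1 : Num.max l 0 < 1 by rewrite gt_max l1 ltr01.
have ls : Num.max l 0 < s by rewrite /s; lra.
have s1 : s < 1 by rewrite /s; lra.
have s0 : 0 < s by apply: le_lt_trans ls; rewrite le_max lexx orbT.
have /(cvgr_lt l) /(_ s) [] := rl.
  by apply: le_lt_trans ls; rewrite le_max lexx.
move=> N _ rs.
(* K is large enough for b n <= K s^n on the finitely many n <= N; from N on
   the recurrence propagates this bound. *)
pose K := \sum_(i < N.+1) b i / s ^+ i.
have small n : (n <= N)%N -> b n <= K * s ^+ n.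
  move=> nN; rewrite -ler_pdivrMr ?exprn_gt0 // /K.
  rewrite (bigD1 (Ordinal (nN : (n < N.+1)%N))) //= lerDl sumr_ge0 // => i _.
  by rewrite divr_ge0 // exprn_ge0 // ltW.
have bK n : b n <= K * s ^+ n.
  have [/small//|/ltnW /subnK <-] := leqP n N.
  elim: (n - N)%N => [|k IH]; first exact: small.
  rewrite addSn exprS mulrCA; apply: le_trans (br _) _.
  apply: (@le_trans _ _ (s * b (k + N)%N)); last by rewrite ler_wpM2l // ltW.
  by rewrite ler_wpM2r // ltW // rs //= leq_addl.
have K0 : 0 <= K by apply: le_trans (b0 0%N) _; rewrite (le_trans (bK _)) ?mulr1.
apply: (series_le_cvg b0 _ bK) => [n|].
  by rewrite mulr_ge0 // exprn_ge0 // ltW.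
by apply: (is_cvg_geometric_series (a := K)); rewrite ger0_norm // ltW.
Qed.

Lemma complex_series_cvg (u : nat -> C) (b : nat -> R) :
  (forall d, cabs (u d) <= b d) -> cvgn (series b) -> cvgn (series u).
Proof.
move=> ub cb.
have dom (v : nat -> R) : (forall d, `|v d| <= cabs (u d)) -> cvgn (series v).
  move=> vu; apply: normed_cvg.
  apply: (series_le_cvg _ _ _ cb) => d //=; last exact: le_trans (ub d).
  exact: le_trans (cabs_ge0 _) (ub d).
have /dom re : forall d, `|complex.Re (u d)| <= cabs (u d) by move=> d; exact: cabs_Re.
have /dom im : forall d, `|complex.Im (u d)| <= cabs (u d) by move=> d; exact: cabs_Im.
apply/cvg_ex; eexists (Complex (limn _) (limn _)).
apply: cvg_complex => /=.
  have -> : (fun n => complex.Re (series u n)) = series (fun d => complex.Re (u d)).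
    by apply/funext => n; rewrite /series /= raddf_sum.
  exact: re.
have -> : (fun n => complex.Im (series u n)) = series (fun d => complex.Im (u d)).
  by apply/funext => n; rewrite /series /= raddf_sum.
exact: im.
Qed.

Lemma series_tail_bound (u : nat -> C) (b : nat -> R) n :
  (forall d, cabs (u d) <= b d) -> cvgn (series b) ->
  cabs (limn (series u) - series u n) <= limn (series b) - series b n.
Proof.
move=> ub cb.
have cu := complex_series_cvg ub cb.
have c1 : cabs (series u m - series u n) @[m --> \oo] -->
    cabs (limn (series u) - series u n).
  by apply: cvg_cabs; apply: cvgB; [exact: cu|exact: cvg_cst].
have c2 : (series b m - series b n) @[m --> \oo] --> limn (series b) - series b n.
  by apply: cvgB; [exact: cb|exact: cvg_cst].
apply: (ler_cvg_to c1 c2); exists n => // m /= nm.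
rewrite !sub_series_geq //; apply: le_trans (cabs_sum _ _ _) _.
exact: ler_sum.
Qed.

(** Dominated convergence for series (Tannery): the domination makes the tails
    uniformly small, and a finite partial sum converges term by term. *)
Lemma tannery (T : Type) (F : set_system T) {FF : ProperFilter F}
    (u : T -> nat -> C) (v : nat -> C) (b : nat -> R) :
  cvgn (series b) -> (forall d, u x d @[x --> F] --> v d) ->
  (\forall x \near F, forall d, cabs (u x d) <= b d) ->
  limn (series (u x)) @[x --> F] --> limn (series v).
Proof.
move=> cb uv ub.
have vb d : cabs (v d) <= b d.
  apply: (cvg_le_const (cvg_cabs (uv d))).
  by apply: filterS ub => x; exact.
apply/cvgC_cabs => e e0; have e3 : 0 < e / 3 by rewrite divr_gt0.
have /cvgrPdist_lt/(_ _ e3) [n _ /(_ n (leqnn n)) tail] := cb.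
have /cvgC_cabs/(_ _ e3) part : series (u x) n @[x --> F] --> series v n.
  by rewrite /series /=; apply: cvg_sumr => i _; exact: uv.
apply: filterS2 part ub => x part ub.
have tx := series_tail_bound n ub cb.
have tv := series_tail_bound n vb cb.
have := cabs_triangle (limn (series v)) (series v n) (limn (series (u x))).
have := cabs_triangle (series v n) (series (u x) n) (limn (series (u x))).
rewrite [cabs (_ - limn _)]cabsB in tx *.
move: (ler_norm (limn (series b) - series b n)) => *.
have := cabsB (series (u x) n) (limn (series (u x))).
lra.
Qed.

End DominatedSeries.

(** * Norm and coefficientwise convergence in the truncated polynomial ring *)

Section TruncatedRing.
Variable R : realType.
Local Notation C := R[i].
Local Notation cabs := (@Normc.normc R).
Implicit Types x y : truncH R.

(** Reduction modulo H^4 forgets the coefficients of index at least 4 and keeps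
    the others, so products are computed by the Cauchy formula. *)
Lemma coef_in_qpoly (p : {poly C}) k : (k < 4)%N -> (in_qpoly (X4 R) p)`_k = p`_k.
Proof.
move=> k4.
change ((Pdiv.CommonRing.rmodp p (mk_monic (X4 R)))`_k = p`_k).
by rewrite mk_monic_X4 -Pdiv.RingMonic.take_poly_rmodp coef_take_poly k4.
Qed.

Lemma in_qpolyK x : in_qpoly (X4 R) x = x.
Proof. by apply/val_inj/in_qpoly_small; exact: size_mk_monic. Qed.

Lemma coefHD x y k : (x + y)`_k = x`_k + y`_k.
Proof. by rewrite poly_of_qpolyD coefD. Qed.

Lemma coefHZ a x k : (a *: x)`_k = a * x`_k.
Proof. by rewrite poly_of_qpolyZ coefZ. Qed.

Lemma coefHN x k : (- x)`_k = - x`_k.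
Proof. by rewrite -scaleN1r coefHZ mulN1r. Qed.

Lemma coefHB x y k : (x - y)`_k = x`_k - y`_k.
Proof. by rewrite coefHD coefHN. Qed.

Lemma coefH0 k : (0 : truncH R)`_k = 0.
Proof. by rewrite coef0. Qed.

Lemma coefH_sum (I : Type) (s : seq I) (P : pred I) (f : I -> truncH R) k :
  (\sum_(i <- s | P i) f i)`_k = \sum_(i <- s | P i) (f i)`_k.
Proof.
by elim/big_rec2: _ => [|i a b _ <-]; [exact: coefH0|exact: coefHD].
Qed.

Lemma coefHM x y k : (k < 4)%N -> (x * y)`_k = \sum_(i < k.+1) x`_i * y`_(k - i).
Proof.
move=> k4; rewrite -{1}[x]in_qpolyK -{1}[y]in_qpolyK -in_qpolyM.
by rewrite coef_in_qpoly // coefM.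
Qed.

Lemma coefH_XH j k : (k < 4)%N -> ((H : truncH R) ^+ j)`_k = (k == j)%:R.
Proof. by move=> k4; rewrite /H -rmorphXn coef_in_qpoly //= coefXn. Qed.

Lemma coefH1 k : (k < 4)%N -> (1 : truncH R)`_k = (k == 0%N)%:R.
Proof. by move=> k4; rewrite -(expr0 H) coefH_XH. Qed.

Lemma coefH_hsum (u : nat -> truncH R) k : (k < 4)%N ->
  (hsum u)`_k = limn (series (fun d => (u d)`_k)).
Proof. by move=> k4; rewrite /hsum coef_in_qpoly // coef_poly k4. Qed.

Lemma coefH_expH c k : (k < 4)%N -> (expH c : truncH R)`_k = c ^+ k / k`!%:R.
Proof.
move=> k4; rewrite /expH coefH_sum (bigD1 (Ordinal k4)) //= coefHZ coefH_XH //.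
rewrite eqxx mulr1 big1 ?addr0 // => i ik.
rewrite coefHZ coefH_XH // eq_sym; move: ik; rewrite -val_eqE => /= /negPf ->.
by rewrite mulr0.
Qed.

(** Such an element is a multiple of H, and H^4 = 0. *)
Lemma nilpotentH y : y`_0 = 0 -> y ^+ 4 = 0.
Proof.
move=> y0; pose m := in_qpoly (X4 R) (y %/ 'X).
suff -> : y = H * m by rewrite exprMn H4_eq0 mul0r.
rewrite -[LHS]in_qpolyK /H /m -in_qpolyM mulrC; congr in_qpoly.
rewrite divpK //.
by rewrite -[X in X %| _]subr0 -polyC0 dvdp_XsubCl rootE horner_coef0 y0.
Qed.

Lemma geometricH y : y`_0 = 0 ->
  1 - y \is a GRing.unit /\ (1 - y)^-1 = \sum_(i < 4) y ^+ i.
Proof.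
move=> /nilpotentH y4.
have e : (1 - y) * (\sum_(i < 4) y ^+ i) = 1.
  by rewrite -opprB mulNr -subrX1 y4 sub0r opprK.
have u : 1 - y \is a GRing.unit.
  by apply/unitrP; exists (\sum_(i < 4) y ^+ i); split => //; rewrite mulrC.
by split => //; apply: (mulrI u); rewrite divrr // e.
Qed.

(** After division by its constant term, x is 1 minus a nilpotent element, and
    the geometric series inverts it. The explicit formula shows that inversion
    is continuous. *)
Lemma invHE x : x`_0 != 0 -> x \is a GRing.unit /\
  x^-1 = (x`_0)^-1 *: \sum_(i < 4) (1 - (x`_0)^-1 *: x) ^+ i.
Proof.
move=> x0; set a := x`_0 in x0 *.
have [] := @geometricH (1 - a^-1 *: x).
  by rewrite coefHB coefHZ coefH1 // mulVf // subrr.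
rewrite opprB addrC subrK => u e.
have xE : x = a *: (a^-1 *: x) by rewrite scalerA mulfV // scale1r.
have ua : a \is a GRing.unit by rewrite unitfE.
by rewrite -e {1 2}xE; split; [rewrite scaler_unit|rewrite invrZ].
Qed.

(** The l^1 norm of the coefficients: it is submultiplicative, which is what the
    domination of a product of many factors needs. *)
Definition normH x : R := \sum_(k < 4) cabs x`_k.

Lemma normH_ge0 x : 0 <= normH x.
Proof. by apply: sumr_ge0 => k _; exact: cabs_ge0. Qed.

Lemma le_coef_normH x k : (k < 4)%N -> cabs x`_k <= normH x.
Proof.
move=> k4; rewrite /normH (bigD1 (Ordinal k4)) //= lerDl sumr_ge0 // => i _.
exact: cabs_ge0.
Qed.

Lemma normHD x y : normH (x + y) <= normH x + normH y.
Proof.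
rewrite /normH -big_split; apply: ler_sum => k _.
by rewrite coefHD cabsD.
Qed.

Lemma normHZ a x : normH (a *: x) = cabs a * normH x.
Proof.
by rewrite /normH mulr_sumr; apply: eq_bigr => k _; rewrite coefHZ Normc.normcM.
Qed.

Lemma normHN x : normH (- x) = normH x.
Proof. by rewrite -scaleN1r normHZ cabsN Normc.normc1 mul1r. Qed.

Lemma normHE x : normH x = cabs x`_0 + cabs x`_1 + cabs x`_2 + cabs x`_3.
Proof. by rewrite /normH !big_ord_recr big_ord0 /= add0r. Qed.

Lemma normH1 : normH 1 = 1.
Proof. by rewrite normHE !coefH1 //= !expr0n expr1n !addr0 sqrtr1 sqrtr0 !addr0. Qed.

Lemma normHM x y : normH (x * y) <= normH x * normH y.
Proof.
have coef_le k : (k < 4)%N ->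
    cabs (x * y)`_k <= \sum_(i < k.+1) cabs x`_i * cabs y`_(k - i).
  move=> k4; rewrite coefHM //; apply: le_trans (cabs_sum _ _ _) _.
  by apply: ler_sum => i _; rewrite Normc.normcM.
set a := fun i => cabs x`_i; set b := fun i => cabs y`_i.
have c0 : cabs (x * y)`_0 <= a 0%N * b 0%N.
  by apply: le_trans (coef_le 0%N isT) _; rewrite !big_ord_recr big_ord0 /= add0r.
have c1 : cabs (x * y)`_1 <= a 0%N * b 1%N + a 1%N * b 0%N.
  by apply: le_trans (coef_le 1%N isT) _; rewrite !big_ord_recr big_ord0 /= add0r.
have c2 : cabs (x * y)`_2 <= a 0%N * b 2%N + a 1%N * b 1%N + a 2%N * b 0%N.
  by apply: le_trans (coef_le 2%N isT) _; rewrite !big_ord_recr big_ord0 /= add0r.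
have c3 : cabs (x * y)`_3 <=
    a 0%N * b 3%N + a 1%N * b 2%N + a 2%N * b 1%N + a 3%N * b 0%N.
  by apply: le_trans (coef_le 3%N isT) _; rewrite !big_ord_recr big_ord0 /= add0r.
have p i j : 0 <= a i * b j by rewrite mulr_ge0 ?cabs_ge0.
(* The terms of the full product that H^4 = 0 kills. *)
have := (p 1%N 3%N, p 2%N 2%N, p 2%N 3%N, p 3%N 1%N, p 3%N 2%N, p 3%N 3%N).
rewrite !normHE -!/(a _) -!/(b _).
move: c0 c1 c2 c3; move: (a 0%N) (a 1%N) (a 2%N) (a 3%N) (b 0%N) (b 1%N) (b 2%N) (b 3%N).
move: (cabs (x * y)`_0) (cabs (x * y)`_1) (cabs (x * y)`_2) (cabs (x * y)`_3).
move=> ? ? ? ? ? ? ? ? ? ? ? ? ? ? ? ? [[[[[? ?] ?] ?] ?] ?]; lra.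
Qed.

Lemma normHX x n : normH (x ^+ n) <= normH x ^+ n.
Proof.
elim: n => [|n IH]; first by rewrite !expr0 normH1.
by rewrite !exprS; apply: le_trans (normHM _ _) _; rewrite ler_wpM2l ?normH_ge0.
Qed.

Lemma normH_sum (I : Type) (s : seq I) (P : pred I) (f : I -> truncH R) :
  normH (\sum_(i <- s | P i) f i) <= \sum_(i <- s | P i) normH (f i).
Proof.
elim/big_rec2: _ => [|i a b _ le_ba].
  by rewrite -(scale0r 1) normHZ Normc.normc0 mul0r.
by apply: le_trans (normHD _ _) _; rewrite lerD2l.
Qed.

Lemma normH_prod (I : Type) (s : seq I) (P : pred I) (f : I -> truncH R) :
  normH (\prod_(i <- s | P i) f i) <= \prod_(i <- s | P i) normH (f i).
Proof.
elim/big_rec2: _ => [|i a b _ le_ba]; first by rewrite normH1.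
by apply: le_trans (normHM _ _) _; rewrite ler_wpM2l ?normH_ge0.
Qed.

Lemma normHV y : y`_0 = 0 -> normH (1 - y)^-1 <= \sum_(i < 4) normH y ^+ i.
Proof.
move=> /geometricH[_ ->]; apply: le_trans (normH_sum _ _ _) _.
by apply: ler_sum => i _; exact: normHX.
Qed.

Section Cvg.
Context {T : Type} {F : set_system T} {FF : Filter F}.

(** Convergence of each of the four coefficients. *)
Definition cvgH (f : T -> truncH R) (l : truncH R) :=
  forall k, (k < 4)%N -> (f t)`_k @[t --> F] --> l`_k.

Lemma cvgH_cst l : cvgH (fun=> l) l.
Proof. by move=> k _; exact: cvg_cst. Qed.

Lemma cvgHZ (a : T -> C) (b : C) f l : a t @[t --> F] --> b -> cvgH f l ->
  cvgH (fun t => a t *: f t) (b *: l).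
Proof.
move=> ab fl k k4; rewrite coefHZ; under eq_fun do rewrite coefHZ.
by apply: cvgM; [exact: ab|exact: fl].
Qed.

Lemma cvgHB f g l m : cvgH f l -> cvgH g m -> cvgH (fun t => f t - g t) (l - m).
Proof.
move=> fl gm k k4; rewrite coefHB; under eq_fun do rewrite coefHB.
by apply: cvgB; [exact: fl|exact: gm].
Qed.

Lemma cvgHM f g l m : cvgH f l -> cvgH g m -> cvgH (fun t => f t * g t) (l * m).
Proof.
move=> fl gm k k4; rewrite coefHM //; under eq_fun do rewrite coefHM //.
apply: cvg_sumr => i _.
have ik : (i < 4)%N by apply: leq_trans k4; exact: ltn_ord.
apply: cvgM; [exact: fl|apply: gm; exact: leq_ltn_trans (leq_subr _ _) k4].
Qed.

Lemma cvgH_sum (I : Type) (s : seq I) (P : pred I) (f : I -> T -> truncH R) l :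
  (forall i, P i -> cvgH (f i) (l i)) ->
  cvgH (fun t => \sum_(i <- s | P i) f i t) (\sum_(i <- s | P i) l i).
Proof.
move=> fl k k4; rewrite coefH_sum; under eq_fun do rewrite coefH_sum.
by apply: cvg_sumr => i Pi; exact: fl.
Qed.

Lemma cvgH_prod (I : Type) (s : seq I) (P : pred I) (f : I -> T -> truncH R) l :
  (forall i, P i -> cvgH (f i) (l i)) ->
  cvgH (fun t => \prod_(i <- s | P i) f i t) (\prod_(i <- s | P i) l i).
Proof.
move=> fl; elim: s => [|i s IH].
  by rewrite big_nil; under eq_fun do rewrite big_nil; exact: cvgH_cst.
rewrite big_cons; under eq_fun do rewrite big_cons.
by case: ifP => Pi; [apply: cvgHM; [exact: fl|exact: IH]|exact: IH].
Qed.

Lemma cvgHX f l n : cvgH f l -> cvgH (fun t => f t ^+ n) (l ^+ n).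
Proof.
move=> fl; elim: n => [|n IH]; first exact: cvgH_cst.
rewrite exprS; under eq_fun do rewrite exprS.
exact: cvgHM.
Qed.

Lemma cvgH_near f g l : (\forall t \near F, f t = g t) -> cvgH f l -> cvgH g l.
Proof.
move=> fg fl k k4; apply: cvg_trans (fl k k4).
by apply: near_eq_cvg; apply: filterS fg => t ->.
Qed.

Lemma cvgHV (f : T -> truncH R) (l : truncH R) : l`_0 != 0 -> cvgH f l ->
  cvgH (fun t => (f t)^-1) l^-1.
Proof.
move=> l0 fl; have fl0 := fl 0%N isT.
have nz : \forall t \near F, (f t)`_0 != 0 by exact: cvgr_neq0 fl0 l0.
rewrite (invHE l0).2; apply: cvgH_near.
  by apply: filterS nz => t /invHE[_ e]; rewrite e; reflexivity.
apply: cvgHZ; first exact: cvgV.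
apply: cvgH_sum => i _; apply: cvgHX; apply: cvgHB; first exact: cvgH_cst.
by apply: cvgHZ; [exact: cvgV|exact: fl].
Qed.

End Cvg.
End TruncatedRing.

(** * Ratios of the factors of the q-Pochhammer symbols *)

Section HypergeometricLimit.
Variable R : realType.
Local Notation C := R[i].
Local Notation cabs := (@Normc.normc R).
Implicit Types t x : R.

(** This is 1 + y <= e^y; it controls 1 - q^x from below, both for the limit and
    for the uniform bounds. *)
Lemma expR_lb (y : R) : 0 <= y -> y / (1 + y) <= 1 - expR (- y).
Proof.
move=> y0; have y1 : 0 < 1 + y by lra.
rewrite expRN ler_pdivrMr // mulrBl mul1r.
have e := expR_ge1Dx y; have e0 := expR_gt0 y.
have : (expR y)^-1 * (1 + y) <= 1 by rewrite mulrC ler_pdivrMr ?mul1r.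
lra.
Qed.

Definition qfactor (t x : R) : truncH R := 1 - qpow t x *: qH t.

Lemma coef_qfactor t x k : (k < 4)%N ->
  (qfactor t x)`_k =
    ((k == 0%N)%:R - expR (- (t * x)) * ((- t) ^+ k / k`!%:R))%:C%C.
Proof.
move=> k4; rewrite coefHB coefHZ coefH1 // coefH_expH //.
by rewrite rmorphB rmorphM fmorph_div rmorphXn /= !rmorph_nat.
Qed.

Lemma cvg_at0 (f : R -> R) (l : R) : {for 0, continuous f} -> f 0 = l ->
  f t @[t --> (0 : R)^'+] --> l.
Proof. by move=> cf <-; apply: cvg_at_right_filter. Qed.

(** The factor 1 - e^{-t (x + H)} is t (x + H) to first order, so rescaled by t
    a q-Pochhammer symbol degenerates to an ordinary one. *)
Lemma cvg_qfactor x : 0 <= x ->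
  cvgH (F := (0 : R)^'+) (fun t => (t^-1)%:C%C *: qfactor t x) (H + x%:C%C%:A).
Proof.
move=> x0 k k4.
under eq_fun do rewrite coefHZ coef_qfactor // -rmorphM.
rewrite coefHD coefHZ coefH1 // -[H]expr1 coefH_XH //.
have -> : (k == 1%N)%:R + x%:C%C * (k == 0%N)%:R =
    ((k == 1%N)%:R + x * (k == 0%N)%:R)%:C%C :> C.
  by rewrite rmorphD rmorphM /= !rmorph_nat.
apply: cvg_real_complex.
have ce n : (expR (- (t * x)) * t ^+ n) @[t --> (0 : R)^'+] --> (0 ^+ n : R).
  apply: cvg_at0; last by rewrite mul0r oppr0 expR0 mul1r.
  apply: cvgM; last exact: exprn_continuous.
  apply: continuous_comp; last exact: continuous_expR.
  by apply: cvgN; apply: cvgMl; exact: cvg_id.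
case: k k4 => [_|k k4] /=.
  rewrite !mulr1 add0r.
  under eq_fun do rewrite expr0 fact0 invr1 !mulr1.
  apply: (@squeeze_cvgr _ _ _ _ (fun t => x / (1 + t * x)) (fun=> x)).
  - near=> t; have t0 : 0 < t by near: t; exact: nbhs_right_gt.
    rewrite -[X in _ <= X <= _]mulrC; apply/andP; split.
      by rewrite ler_pdivlMr // mulrAC [x * t]mulrC expR_lb // mulr_ge0 // ltW.
    rewrite ler_pdivrMr //; have := expR_ge1Dx (- (t * x)); lra.
  - apply: cvg_at0; last by rewrite mul0r addr0 divr1.
    apply: cvgM; first exact: cvg_cst.
    apply: cvgV; first by rewrite mul0r addr0 oner_neq0.
    by apply: cvgD; [exact: cvg_cst|apply: cvgMl; exact: cvg_id].
  - exact: cvg_cst.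
rewrite mulr0 addr0.
have -> : (k.+1 == 1%N)%:R = 0 ^+ k * ((- 1) ^+ k / k.+1`!%:R) :> R.
  by case: k {k4} => [|k]; rewrite /= ?expr0n /= ?mul0r // expr0 factS fact0 divr1 !mul1r.
have h : expR (- (t * x)) * t ^+ k * ((- 1) ^+ k / k.+1`!%:R) @[t --> (0 : R)^'+]
    --> (0 ^+ k * ((- 1) ^+ k / k.+1`!%:R) : R).
  by apply: cvgM; [exact: ce|exact: cvg_cst].
apply: cvg_trans h.
apply: near_eq_cvg; near=> t; have t0 : t != 0 by near: t; exact: nbhs_right_neq.
rewrite sub0r [(- t) ^+ _]exprNn exprSr exprS; set f := k.+1`!%:R.
have f0 : f != 0 :> R by rewrite pnatr_eq0 -lt0n fact_gt0.
by field; rewrite t0 andbT.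
Unshelve. all: by end_near. Qed.

(** Dividing the factor 1 - q^x P by its scalar part 1 - q^x leaves 1 minus this
    nilpotent element. The scalar parts have ratios at most 1 and the nilpotent
    parts are O(1/x), both uniformly in t. *)
Definition qnil (t x : R) : truncH R :=
  - (qpow t x / (1 - qpow t x)) *: (1 - qH t : truncH R).

Lemma qpowE t x : qpow t x = (expR (- (t * x)))%:C%C. Proof. by []. Qed.

Lemma qpow_lt1 t x : 0 < t -> 0 < x -> expR (- (t * x)) < 1.
Proof. by move=> t0 x0; rewrite expR_lt1 oppr_lt0 mulr_gt0. Qed.

Lemma one_sub_qpow t x : 1 - qpow t x = (1 - expR (- (t * x)))%:C%C.
Proof. by rewrite rmorphB. Qed.

Lemma one_sub_qpow_neq0 t x : 0 < t -> 0 < x -> 1 - qpow t x != 0.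
Proof.
move=> t0 x0; rewrite one_sub_qpow (inj_eq (@complexI R) _ 0) subr_eq0 eq_sym.
by rewrite lt_eqF // qpow_lt1.
Qed.

Lemma qfactorE t x : 0 < t -> 0 < x ->
  qfactor t x = (1 - qpow t x) *: (1 - qnil t x).
Proof.
move=> t0 x0; have c0 := one_sub_qpow_neq0 t0 x0.
rewrite /qfactor /qnil scaleNr opprK scalerDr scalerA mulrC divfK //.
by rewrite scalerBl scalerBr scale1r addrA subrK.
Qed.

Lemma qnil0 t x : (qnil t x)`_0 = 0.
Proof.
by rewrite coefHZ coefHB coefH1 // coefH_expH //= expr0 fact0 divr1 subrr mulr0.
Qed.

(** The coefficient q^x / (1 - q^x) is at most 1/(t x), and 1 - P has norm at
    most 2 t when t <= 1: the two powers of t cancel. *)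
Lemma norm_qnil t x : 0 < t <= 1 -> 0 < x -> normH (qnil t x) <= 2 / x.
Proof.
move=> /andP[t0 t1] x0.
have P1 : normH (1 - qH t) <= 2 * t.
  have cE k : (k < 4)%N -> cabs (1 - qH t : truncH R)`_k =
      `|(k == 0%N)%:R - (- t) ^+ k / k`!%:R|.
    move=> k4; rewrite coefHB coefH1 // coefH_expH // -cabs_real.
    by rewrite rmorphB fmorph_div rmorphXn /= !rmorph_nat.
  rewrite normHE !cE // !factS fact0 eqxx expr0 divr1 subrr normr0 !sub0r !normrN !normrM.
  rewrite !normrX !normfV !normr_nat normrN (ger0_norm (ltW t0)).
  have t2 : t ^+ 2 <= t by rewrite expr2 ger_pMl.
  have t3 : t ^+ 3 <= t by rewrite exprS (le_trans _ t2) // expr2 ler_pM2l.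
  lra.
rewrite normHZ; have y0 : 0 < t * x by rewrite mulr_gt0.
have c1 := qpow_lt1 t0 x0.
have -> : cabs (- (qpow t x / (1 - qpow t x))) =
    expR (- (t * x)) / (1 - expR (- (t * x))).
  rewrite cabsN one_sub_qpow qpowE -fmorph_div cabs_real ger0_norm //.
  by rewrite divr_ge0 ?expR_ge0 // subr_ge0 ltW.
apply: le_trans (ler_wpM2l _ P1) _.
  by rewrite divr_ge0 ?expR_ge0 // subr_ge0 ltW.
have := expR_lb (ltW y0); move: c1; set c := expR _ => c1.
rewrite ler_pdivrMr; last lra.
move=> h; rewrite mulrAC ler_pdivrMr; last lra.
have -> : 2 / x * (1 - c) = 2 * t * ((1 - c) / (t * x)).
  by field; rewrite !gt_eqF.
rewrite mulrC ler_pM2l; last lra.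
rewrite ler_pdivlMr //; lra.
Qed.

Lemma qfactor_unit t x : 0 < t -> 0 < x -> qfactor t x \is a GRing.unit.
Proof.
move=> t0 x0; rewrite qfactorE // scaler_unit; first exact: (geometricH (qnil0 t x)).1.
by rewrite unitfE one_sub_qpow_neq0.
Qed.

(** It tends to 1 when a and b tend to infinity, which is all that the ratio test
    asks for. *)
Definition ratio_bound (a b : R) : R := (1 + 2 / a) * \sum_(j < 4) (2 / b) ^+ j.

Lemma norm_qfactor_ratio t a b : 0 < t <= 1 -> 0 < a -> a <= b ->
  normH (qfactor t a / qfactor t b) <= ratio_bound a b.
Proof.
move=> /[dup] t01 /andP[t0 _] a0 ab; have b0 : 0 < b by exact: lt_le_trans ab.
rewrite !qfactorE // invrZ ?unitfE ?one_sub_qpow_neq0 //; last first.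
  exact: (geometricH (qnil0 t b)).1.
rewrite -scalerAl -scalerAr scalerA normHZ.
apply: (@le_trans _ _ (1 * normH ((1 - qnil t a) / (1 - qnil t b)))).
  apply: ler_wpM2r; first exact: normH_ge0.
  rewrite !one_sub_qpow -fmorph_div cabs_real.
  have ca := qpow_lt1 t0 a0; have cb := qpow_lt1 t0 b0.
  rewrite ger0_norm ?divr_ge0 ?subr_ge0 ?(ltW ca) ?(ltW cb) //.
  rewrite ler_pdivrMr ?subr_gt0 // mul1r lerD2l lerN2 ler_expR lerN2.
  by rewrite ler_pM2l.
rewrite mul1r; apply: le_trans (normHM _ _) _; apply: ler_pM; try exact: normH_ge0.
  apply: le_trans (normHD _ _) _; rewrite normH1 normHN lerD2l.
  exact: norm_qnil.
apply: le_trans (normHV (qnil0 _ _)) _; apply: ler_sum => j _.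
by apply: lerXn2r; rewrite ?nnegrE ?normH_ge0 ?divr_ge0 ?(ltW b0) // norm_qnil.
Qed.

Lemma invr_prodH (b : nat -> truncH R) d :
  (forall k, b k \is a GRing.unit) ->
  (\prod_(k < d) b k)^-1 = \prod_(k < d) (b k)^-1.
Proof.
move=> ub; have up n : \prod_(k < n) b k \is a GRing.unit by exact: unitr_prod.
elim: d => [|d IH]; first by rewrite !big_ord0 invr1.
by rewrite !big_ord_recr /= (invrM (up d) (ub d)) IH mulrC.
Qed.

(** In this form consecutive terms of the series have an explicit ratio, both in
    the q-series and in its limit. *)
Lemma hypergeometric_term (a : nat -> nat -> truncH R) (b : nat -> truncH R)
    (Q : C) d : (forall k, b k \is a GRing.unit) ->
  Q ^+ d *: ((\prod_(1 <= i < 5) \prod_(k < d) a i k) / (\prod_(k < d) b k) ^+ 4)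
  = \prod_(k < d) (Q *: \prod_(1 <= i < 5) (a i k / b k)).
Proof.
move=> ub; rewrite scaler_prod prodr_const card_ord; congr (_ *: _).
rewrite exchange_big /= -exprVn invr_prodH // -prodrXl -big_split /=.
apply: eq_bigr => k _.
by rewrite big_split /= prodr_const_nat.
Qed.

End HypergeometricLimit.

(** * Limits of the basic hypergeometric series and of the power of P *)

Section HypergeometricSeries.
Variable R : realType.
Local Notation C := R[i].
Local Notation cabs := (@Normc.normc R).
Implicit Types t x : R.

Let node (i k : nat) : R := i%:R / 5 + k%:R.

Let node_gt0 i k : (0 < i)%N -> 0 < node i k.
Proof. by move=> i0; rewrite ltr_wpDr // divr_gt0 // ltr0n. Qed.

Let qterm (Q : C) t d : truncH R :=
  Q ^+ d *: ((\prod_(1 <= i < 5) qpoch (qpow t (i%:R / 5) *: qH t) (qpow t 1) d)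
             / qpoch (qpow t 1 *: qH t) (qpow t 1) d ^+ 4).

Let term (Q : C) d : truncH R :=
  Q ^+ d *: ((\prod_(1 <= i < 5) poch (H + (i%:R / 5)%:A) d) / poch (H + 1) d ^+ 4).

Lemma qpow_shift t x k : qpow t 1 ^+ k * qpow t x = qpow t (x + k%:R).
Proof.
rewrite !qpowE -rmorphXn -rmorphM -expRM_natl -expRD; congr (expR _)%:C%C; ring.
Qed.

Lemma qpoch_qfactor t x d :
  qpoch (qpow t x *: qH t) (qpow t 1) d = \prod_(k < d) qfactor t (x + k%:R).
Proof. by apply: eq_bigr => k _; rewrite scalerA qpow_shift. Qed.

Let qtermE Q t d : 0 < t -> qterm Q t d =
  \prod_(k < d) (Q *: \prod_(1 <= i < 5) (qfactor t (node i k) / qfactor t (1 + k%:R))).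
Proof.
move=> t0; rewrite /qterm qpoch_qfactor; under eq_bigr do rewrite qpoch_qfactor.
rewrite (hypergeometric_term (fun i k => qfactor t (node i k))
  (b := fun k => qfactor t (1 + k%:R))) // => k.
by apply: qfactor_unit; rewrite // ltr_wpDr.
Qed.

Lemma linH_unit (x : R) : x != 0 -> (H + x%:C%C%:A : truncH R) \is a GRing.unit.
Proof.
move=> x0; apply: (invHE _).1; rewrite coefHD coefHZ coefH1 // -[H]expr1 coefH_XH //.
by rewrite add0r mulr1 (inj_eq (@complexI R) _ 0).
Qed.

Let termE Q d : term Q d =
  \prod_(k < d) (Q *: \prod_(1 <= i < 5)
    ((H + (node i k)%:C%C%:A) / (H + (1 + k%:R)%:C%C%:A))).
Proof.
have e (x : R) k : H + (x + k%:R)%:C%C%:A = H + x%:C%C%:A + k%:R :> truncH R.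
  by rewrite rmorphD /= rmorph_nat scalerDl scaler_nat addrA.
have u k : (H + (1 + k%:R)%:C%C%:A : truncH R) \is a GRing.unit.
  by apply: linH_unit; rewrite gt_eqF // ltr_wpDr.
rewrite -(hypergeometric_term (fun i k => H + (node i k)%:C%C%:A) Q d u).
congr (_ *: (_ / _ ^+ 4)); last first.
  by apply: eq_bigr => k _; rewrite e rmorph1 scale1r.
apply: eq_bigr => i _; apply: eq_bigr => k _.
by rewrite e rmorphM fmorphV !rmorph_nat.
Qed.

Let cvg_qterm Q d : cvgH (F := (0 : R)^'+) (qterm Q ^~ d) (term Q d).
Proof.
rewrite termE.
apply: (@cvgH_near _ _ _ _ (fun t => \prod_(k < d) (Q *: \prod_(1 <= i < 5)
    (((t^-1)%:C%C *: qfactor t (node i k)) /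
     ((t^-1)%:C%C *: qfactor t (1 + k%:R)))))).
  near=> t; have t0 : 0 < t by near: t; exact: nbhs_right_gt.
  rewrite qtermE //; apply: eq_bigr => k _; congr (_ *: _); apply: eq_bigr => i _.
  have tu : (t^-1)%:C%C \is a GRing.unit by rewrite unitfE fmorph_eq0 invr_eq0 gt_eqF.
  rewrite (@invrZ _ _ (t^-1)%:C%C) //; last first.
    by apply: qfactor_unit; rewrite // ltr_wpDr.
  by rewrite -scalerAl -scalerAr scalerA divrr // scale1r.
apply: cvgH_prod => k _; apply: cvgHZ; first exact: cvg_cst.
apply: cvgH_prod => i _; apply: cvgHM.
  by apply: cvg_qfactor; rewrite addr_ge0 // divr_ge0.
apply: cvgHV; last by apply: cvg_qfactor; rewrite addr_ge0.
rewrite coefHD coefHZ coefH1 // -[H]expr1 coefH_XH //.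
by rewrite add0r mulr1 (inj_eq (@complexI R) _ 0) gt_eqF // ltr_wpDr.
Unshelve. all: by end_near. Qed.

(** Up to the factor |Q|, a bound, uniform in t, of the norm of the ratio of the
    terms of index k+1 and k. *)
Let rate k : R := \prod_(1 <= i < 5) ratio_bound (node i k) (1 + k%:R).

Let norm_qterm Q t d : 0 < t <= 1 ->
  normH (qterm Q t d) <= \prod_(k < d) (cabs Q * rate k).
Proof.
move=> /[dup] t01 /andP[t0 _]; rewrite qtermE //; apply: le_trans (normH_prod _ _ _) _.
apply: ler_prod => k _; rewrite normH_ge0 normHZ /=.
apply: ler_wpM2l; first exact: cabs_ge0.
apply: le_trans (normH_prod _ _ _) _.
rewrite /rate !big_nat; apply: ler_prod => i /andP[i0 i5].
rewrite normH_ge0 norm_qfactor_ratio ?node_gt0 //.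
rewrite lerD2r ler_pdivrMr // mul1r ler_nat; exact: ltnW.
Qed.

Let cvg_rate : rate k @[k --> \oo] --> (1 : R).
Proof.
have cinv (x : R) : 2 / (x + k%:R) @[k --> \oo] --> (0 : R).
  have y : (x + k%:R : R) @[k --> \oo] --> +oo.
    apply/cvgryPge => A; near=> k; rewrite -lerBlDl.
    by near: k; exact: nbhs_infty_ger.
  have -> : 0 = 2 * 0 :> R by rewrite mulr0.
  apply: cvgM; first exact: cvg_cst.
  exact: ((gtr0_cvgV0 (cvgry_gt y 0)).2 y).
have -> : 1 = \prod_(1 <= i < 5) ((1 + 0) * \sum_(j < 4) 0 ^+ j) :> R.
  rewrite big1 // => i _; rewrite addr0 mul1r big_ord_recl big1 ?addr0 // => j _.
  by rewrite expr0n.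
apply: cvg_prodr => i _; apply: cvgM.
    by apply: cvgD; [exact: cvg_cst|exact: cinv].
  apply: cvg_sumr => j _.
  by apply: cvg_exprn; exact: cinv.
Unshelve. all: by end_near. Qed.

(** Dominated convergence: each term converges, and for t <= 1 the terms are
    dominated by products of |Q| rate k, whose factors tend to |Q| < 1. *)
Lemma cvg_hypergeometric Q : cabs Q < 1 ->
  cvgH (F := (0 : R)^'+) (fun t => hsum (qterm Q t)) (hsum (term Q)).
Proof.
move=> Q1 k k4; rewrite coefH_hsum //; under eq_fun do rewrite coefH_hsum //.
apply: (@tannery _ _ _ _ (fun t d => (qterm Q t d)`_k) _
  (fun d => \prod_(k < d) (cabs Q * rate k))).
- apply: (@ratio_test _ _ (fun k => cabs Q * rate k) (cabs Q)) => [d|d||//].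
  + by apply: le_trans (norm_qterm Q d (t := 1) _); rewrite ?normH_ge0 ?ltr01 ?lexx.
  + by rewrite big_ord_recr /= mulrC.
  + have {2}-> : cabs Q = cabs Q * 1 by rewrite mulr1.
    by apply: cvgM; [exact: cvg_cst|exact: cvg_rate].
- by move=> d; exact: cvg_qterm.
- near=> t => d; apply: le_trans (le_coef_normH _ k4) _; apply: norm_qterm.
  by apply/andP; split; near: t; [exact: nbhs_right_gt|exact: nbhs_right_le].
Unshelve. all: by end_near. Qed.

(** Since 1 - P is t H to first order, the a-th term carries a factor t^a. One t
    goes to each of the a factors l - r of the binomial coefficient, turning the
    coefficient into L^a / a!. *)
Lemma cvg_powH_qH (l : R -> C) (L : C) :
  (- t%:C%C * l t) @[t --> (0 : R)^'+] --> L ->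
  cvgH (F := (0 : R)^'+) (fun t => powH (qH t) (l t)) (expH L).
Proof.
move=> lL; rewrite /powH /expH.
apply: (@cvgH_near _ _ _ _ (fun t => \sum_(a < 4)
    (a`!%:R^-1 * \prod_(r < a) (- t%:C%C * l t + t%:C%C * r%:R)) *:
    ((t^-1)%:C%C *: qfactor t 0) ^+ a)).
  near=> t; have t0 : t%:C%C != 0 :> C.
    by rewrite fmorph_eq0; near: t; exact: nbhs_right_neq.
  apply: eq_bigr => a _; rewrite /qfactor qpowE mulr0 oppr0 expR0 scale1r.
  rewrite exprZn scalerA; congr (_ *: _); rewrite /binomc.
  have -> : \prod_(r < a) (- t%:C%C * l t + t%:C%C * r%:R) =
      (- t%:C%C) ^+ a * \prod_(r < a) (l t - r%:R).
    rewrite -[X in _ ^+ X]card_ord -prodr_const -big_split /=.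
    by apply: eq_bigr => r _; ring.
  rewrite fmorphV [(- _%:C%C) ^+ a]exprNn exprVn; have : t%:C%C ^+ a != 0 by rewrite expf_neq0.
  have : a`!%:R != 0 :> C by rewrite pnatr_eq0 -lt0n fact_gt0.
  move: (a`!%:R) (t%:C%C ^+ a) ((-1) ^+ a) (\prod_(_ < _) _) => f ta s p f0 ta0.
  by field; rewrite f0 ta0.
apply: cvgH_sum => a _; apply: cvgHZ.
  rewrite mulrC; apply: cvgM; first exact: cvg_cst.
  rewrite -[X in L ^+ X]card_ord -prodr_const; apply: cvg_prodr => r _.
  have -> : L = L + 0%:C%C * r%:R by rewrite mul0r addr0.
  apply: cvgD; first exact: lL.
  apply: cvgM; last exact: cvg_cst.
  by apply: cvg_real_complex; exact: cvg_at_right_filter.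
have -> : H = H + 0%:C%C%:A :> truncH R by rewrite scale0r addr0.
by apply: cvgHX; exact: cvg_qfactor.
Unshelve. all: by end_near. Qed.

End HypergeometricSeries.

(** * The principal logarithm on the slit plane *)

Section LogAlongRay.
Variable R : realType.
Local Notation C := R[i].
Local Notation cabs := (@Normc.normc R).
Implicit Types z Q : C.

(** The right-hand side is the denominator of the half-angle formula for the
    argument. *)
Lemma slitP z : ~~ (z <= 0) = (0 < cabs z + complex.Re z).
Proof.
case: z => x y; rewrite lecE /= negb_and -ltNge.
have [->|y0] := eqVneq y 0; rewrite /=.
  rewrite expr0n addr0 sqrtr_sqr /=.
  case: (lerP x 0) => x0; last by rewrite addr_gt0 // normr_gt0 gt_eqF.
  by rewrite ler0_norm // addNr ltxx.
apply/esym; rewrite -ltrBlDr sub0r.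
apply: le_lt_trans (ler_norm _) _; rewrite normrN -sqrtr_sqr.
by rewrite ltr_sqrt ?ltrDl ?exprn_even_gt0 //= ltr_wpDl ?sqr_ge0 // exprn_even_gt0.
Qed.

Lemma cabs2 z : cabs z ^+ 2 = complex.Re z ^+ 2 + complex.Im z ^+ 2.
Proof. by case: z => x y; rewrite sqr_sqrtr // addr_ge0 ?sqr_ge0. Qed.

(** The half-angle formula. Unlike the definition through acos and a sign it is
    a single smooth expression on the whole slit plane, real axis included. *)
Lemma Arg_atan z : 0 < cabs z + complex.Re z ->
  Arg z = 2 * atan (complex.Im z / (cabs z + complex.Re z)).
Proof.
rewrite /Arg normCE [complex.Re (_)%:C%C]/=; set r := cabs z => s0.
set x := complex.Re z in s0 *; set y := complex.Im z.
have r2 : r ^+ 2 = x ^+ 2 + y ^+ 2 by exact: cabs2.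
have r0 : 0 < r.
  rewrite lt_neqAle cabs_ge0 andbT eq_sym cabs_eq0; apply/eqP => z0.
  by move: s0; rewrite /r /x z0 Normc.normc0 addr0 ltxx.
set w := `|y| / (r + x).
have w0 : 0 <= w by rewrite divr_ge0 // ltW.
(* Half-angle: 1 + w^2 = 2 r / (r + x) and 1 - w^2 = 2 x / (r + x). *)
have cosw : x / r = cos (2 * atan w).
  rewrite [2 * _]mulrC mulr_natr cos_mulr2n cos_atan exprVn sqr_sqrtr; last first.
    by rewrite addr_ge0 // sqr_ge0.
  have -> : w ^+ 2 = (r - x) / (r + x).
    rewrite expr_div_n real_normK ?num_real //.
    have -> : y ^+ 2 = (r - x) * (r + x) by rewrite -subr_sqr r2; ring.
    by field; rewrite gt_eqF.
  have -> : 1 + (r - x) / (r + x) = 2 * r / (r + x) by field; rewrite gt_eqF.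
  rewrite -mulr_natr; field; rewrite !gt_eqF //.
have acw : acos (x / r) = 2 * atan w.
  rewrite cosw cosK // in_itv /=.
  have := atan_ltpi2 w; have : 0 <= atan w by rewrite -(atan0 R) le_atan.
  lra.
rewrite acw /w; case: ifP => y0; first by rewrite ger0_norm.
rewrite ltr0_norm ?ltNge ?y0 // mulNr atanN mulrN opprK //.
Qed.

Lemma slit_cabs_gt0 z : 0 < cabs z + complex.Re z -> 0 < cabs z.
Proof.
rewrite cabs_gt0; apply: contraTneq => ->.
by rewrite Normc.normc0 addr0 ltxx.
Qed.

Lemma cvg_Log (T : Type) (F : set_system T) {FF : Filter F} (f : T -> C) z :
  0 < cabs z + complex.Re z -> f x @[x --> F] --> z ->
  Log (f x) @[x --> F] --> Log z.
Proof.
move=> z0 fz; have cf := @cvg_cabs _ _ _ FF _ _ fz.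
have re := @cvg_Re _ _ _ FF _ _ fz; have im := @cvg_Im _ _ _ FF _ _ fz.
have cs : cabs (f x) + complex.Re (f x) @[x --> F] --> cabs z + complex.Re z.
  by apply: cvgD; [exact: cf|exact: re].
have lnf : ln (cabs (f x)) @[x --> F] --> ln (cabs z).
  exact: cvg_comp _ _ cf (@continuous_ln R _ (slit_cabs_gt0 z0)).
apply: cvg_complex; first exact: lnf.
change (Arg (f x) @[x --> F] --> Arg z).
rewrite Arg_atan //.
have near_slit : \forall x \near F, 0 < cabs (f x) + complex.Re (f x).
  exact: cvgr_gt cs _ z0.
have h : 2 * atan (complex.Im (f x) / (cabs (f x) + complex.Re (f x))) @[x --> F]
    --> 2 * atan (complex.Im z / (cabs z + complex.Re z)).
  have w : complex.Im (f x) / (cabs (f x) + complex.Re (f x)) @[x --> F]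
      --> complex.Im z / (cabs z + complex.Re z).
    apply: cvgM; first exact: im.
    by apply: cvgV; [exact: lt0r_neq0|exact: cs].
  apply: cvgM; first exact: cvg_cst.
  exact: cvg_comp _ _ w (@continuous_atan R _).
apply: cvg_trans h; apply: near_eq_cvg.
by apply: filterS near_slit => x /Arg_atan ->.
Qed.

Section Derivative.
Variables (a b p : R).
Let Q : C := Complex a b.
Let ray (p : R) : C := 1 + p%:C%C * Q.
Let r2 (p : R) : R := (1 + p * a) ^+ 2 + (p * b) ^+ 2.
Hypothesis slit_p : 0 < cabs (ray p) + complex.Re (ray p).

Let rayE s : ray s = Complex (1 + s * a) (s * b).
Proof. by rewrite /ray /Q; apply/eqP; rewrite eq_complex /= !mul0r subr0 addr0 add0r !eqxx. Qed.

Let cabs_ray s : cabs (ray s) = Num.sqrt (r2 s).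
Proof. by rewrite rayE. Qed.

Let r2_gt0 : 0 < r2 p.
Proof. by rewrite -sqrtr_gt0 -cabs_ray slit_cabs_gt0. Qed.

Let dr2 : is_derive p 1 r2 (2 * (a + p * (a ^+ 2 + b ^+ 2))).
Proof.
have di : is_derive p (1 : R) (id : R -> R) (1 : R) := is_derive_id _ _.
have d := is_deriveD (is_deriveD (is_derive_cst (1 : R) p (1 : R))
  (is_deriveZ (2 * a) di)) (is_deriveZ (a ^+ 2 + b ^+ 2) (is_deriveM di di)).
have -> : r2 = cst 1 + (2 * a) \*: id + (a ^+ 2 + b ^+ 2) \*: (id * id).
  apply/funext => s.
  change ((1 + s * a) ^+ 2 + (s * b) ^+ 2 =
    1 + 2 * a * s + (a ^+ 2 + b ^+ 2) * (s * s)).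
  by ring.
by apply: (is_derive_eq d); rewrite /GRing.scale /=; ring.
Qed.

Let dr : is_derive p 1 (fun s => cabs (ray s))
  ((a + p * (a ^+ 2 + b ^+ 2)) / cabs (ray p)).
Proof.
have -> : (fun s => cabs (ray s)) = Num.sqrt \o r2.
  by apply/funext => s; exact: cabs_ray.
have d := is_derive1_comp (is_derive1_sqrt r2_gt0) dr2.
apply: (is_derive_eq d).
rewrite cabs_ray; field; rewrite gt_eqF // sqrtr_gt0 //.
Qed.

Let ray_ratio : Q / ray p = Complex ((a + p * (a ^+ 2 + b ^+ 2)) / r2 p) (b / r2 p).
Proof.
have r20 : r2 p != 0 by rewrite gt_eqF.
have n0 : ray p != 0 by rewrite -cabs_gt0 slit_cabs_gt0.
apply: (mulIf n0); rewrite divfK // rayE /Q; apply/eqP; rewrite eq_complex /=.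
by apply/andP; split; apply/eqP; rewrite /r2; field.
Qed.

(** Together with the next lemma: along the ray p |-> 1 + p Q the principal
    logarithm has derivative Q / (1 + p Q), real and imaginary part apart. *)
Lemma is_derive_ln_ray :
  is_derive p 1 (fun s => ln (cabs (ray s))) (complex.Re (Q / ray p)).
Proof.
have d := @is_derive1_comp R (@ln R) (fun s => cabs (ray s)) p _ _
  (is_derive1_ln (slit_cabs_gt0 slit_p)) dr.
apply: (is_derive_eq d); rewrite ray_ratio [complex.Re (Complex _ _)]/=.
have -> : r2 p = cabs (ray p) ^+ 2 by rewrite cabs_ray sqr_sqrtr // ltW.
move: (slit_cabs_gt0 slit_p); move: (cabs (ray p)) => r r0.
by field; rewrite gt_eqF.
Qed.

Lemma is_derive_arg_ray :
  is_derive p 1 (fun s => 2 * atan (complex.Im (ray s) /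
    (cabs (ray s) + complex.Re (ray s)))) (complex.Im (Q / ray p)).
Proof.
have di : is_derive p (1 : R) (id : R -> R) (1 : R) := is_derive_id _ _.
have dden := is_deriveD dr (is_deriveD (is_derive_cst (1 : R) p (1 : R)) (is_deriveZ a di)).
set den := (_ + _) in dden.
have denE s : den s = cabs (ray s) + complex.Re (ray s).
  by have -> : complex.Re (ray s) = 1 + a * s by rewrite rayE /= mulrC.
have d0 : den p != 0 by rewrite denE gt_eqF.
have dinv := is_deriveV d0 dden.
have d := is_deriveZ 2 (is_derive1_comp (is_derive1_atan _)
   (is_deriveM (is_deriveZ b di) dinv)).
have -> : (fun s => 2 * atan (complex.Im (ray s) / (cabs (ray s) + complex.Re (ray s))))
   = 2 \*: (atan \o ((b \*: id) * (fun s => (den s)^-1))).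
  apply/funext => s; rewrite -denE.
  change (2 * atan (complex.Im (ray s) / den s) = 2 * atan (b * s / den s)).
  by have -> : complex.Im (ray s) = b * s by rewrite rayE /= mulrC.
apply: (is_derive_eq d); rewrite ray_ratio [complex.Im (Complex _ _)]/=.
have rr : r2 p = cabs (ray p) ^+ 2 by rewrite cabs_ray sqr_sqrtr // ltW.
have DE : den p = cabs (ray p) + (1 + a * p) by [].
rewrite rr; move: rr d0 DE (slit_cabs_gt0 slit_p); rewrite /r2.
set D := den p; set m := a ^+ 2 + b ^+ 2.
move: (cabs (ray p)) => r rr D0 DE r0.
have r00 : r != 0 by rewrite gt_eqF.
change (2 * ((1 + (b * p * D^-1) ^+ 2)^-1 *
  (b * p * (- D ^- 2 * ((a + p * m) / r + (0 + a * 1))) + D^-1 * (b * 1)))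
  = b / r ^+ 2).
move: D D0 DE => {dden dinv d denE} D D0 DE.
have -> : 1 + (b * p * D^-1) ^+ 2 = 2 * r / D.
  have e : D ^+ 2 + (p * b) ^+ 2 = 2 * r * D.
    have -> : (p * b) ^+ 2 = r ^+ 2 - (1 + p * a) ^+ 2 by rewrite -rr; ring.
    by rewrite DE; ring.
  have -> : 2 * r / D = (2 * r * D) / D ^+ 2 by field.
  by rewrite -e; field.
have e : p * ((a + p * m) / r + (0 + a * 1)) = D - D / r.
  have rD : r * D = r ^+ 2 + r * (1 + a * p) by rewrite DE; ring.
  have e0 : p * (a + p * m) + p * a * r = r * D - D.
    by rewrite rD -rr DE /m; ring.
  have -> : p * ((a + p * m) / r + (0 + a * 1)) = (p * (a + p * m) + p * a * r) / r.
    by field.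
  by rewrite e0; field.
have -> : b * p * (- D ^- 2 * ((a + p * m) / r + (0 + a * 1))) =
    - (b / D ^+ 2) * (p * ((a + p * m) / r + (0 + a * 1))) by ring.
by rewrite e; field; rewrite r00 D0.
Qed.

End Derivative.
End LogAlongRay.

(** * Riemann sums of the logarithmic derivative along a ray *)

Section RiemannSum.
Variable R : realType.
Local Notation C := R[i].
Local Notation cabs := (@Normc.normc R).
Implicit Types (z Q : C) (c p s t : R).

Definition ray Q p : C := 1 + p%:C%C * Q.

Lemma rayE Q p : ray Q p = Complex (1 + p * complex.Re Q) (p * complex.Im Q).
Proof.
rewrite /ray; case: Q => a b; apply/eqP; rewrite eq_complex /=.
by rewrite !mul0r subr0 addr0 add0r !eqxx.
Qed.

Lemma slit_ray Q p : ~~ (Q <= 0) -> 0 <= p ->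
  0 < cabs (ray Q p) + complex.Re (ray Q p).
Proof.
move=> sQ p0; rewrite -slitP; move: sQ; rewrite rayE; case: Q => a b.
rewrite !lecE /= !negb_and -!ltNge => /orP[b0|a0]; apply/orP.
  move: p0; rewrite le_eqVlt => /predU1P[<-|p0].
    by right; rewrite mul0r addr0 ltr01.
  by left; rewrite eq_sym mulf_eq0 negb_or gt_eqF // eq_sym.
by right; rewrite ltr_pwDl // mulr_ge0 // ltW.
Qed.

Lemma ray_neq0 Q p : ~~ (Q <= 0) -> 0 <= p -> ray Q p != 0.
Proof. by move=> sQ p0; rewrite -cabs_gt0 slit_cabs_gt0 // slit_ray. Qed.

(** By homogeneity this bounds the distance from 0 to the segment [1, Q], which
    misses 0 because Q is off the slit. *)
Lemma ray_lower_bound Q : ~~ (Q <= 0) ->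
  exists2 c, 0 < c & forall p, 0 <= p -> c * (1 + p) <= cabs (ray Q p).
Proof.
rewrite slitP => sQ; have m0 := slit_cabs_gt0 sQ.
have m2 := cabs2 Q; move: sQ m0 m2.
set m := cabs Q; set a := complex.Re Q; set b := complex.Im Q => sQ m0 m2.
(* With k so chosen, Re Q >= - |Q| (1 - k), whence |1 + p Q|^2 >= k (1 + p^2 |Q|^2). *)
pose k := Num.min 1 ((a + m) / m).
have k0 : 0 < k by rewrite lt_min ltr01 divr_gt0 // addrC.
have k1 : k <= 1 by rewrite ge_min lexx.
have ka : - (m * (1 - k)) <= a.
  have : k * m <= a + m by rewrite -ler_pdivlMr // ge_min lexx orbT.
  lra.
pose d := Num.min 1 (m ^+ 2).
have d0 : 0 < d by rewrite lt_min ltr01 exprn_gt0.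
have d1 : d <= 1 by rewrite ge_min lexx.
have dm : d <= m ^+ 2 by rewrite ge_min lexx orbT.
exists (Num.sqrt (k * d / 2)); first by rewrite sqrtr_gt0 divr_gt0 // mulr_gt0.
move=> p p0; rewrite rayE -/a -/b.
rewrite -[1 + p in X in X <= _]ger0_norm ?addr_ge0 // -sqrtr_sqr -sqrtrM; last first.
  by rewrite divr_ge0 // mulr_ge0 // ltW.
apply: ler_wsqrtr.
have -> : (1 + p * a) ^+ 2 + (p * b) ^+ 2 = 1 + 2 * (p * a) + p ^+ 2 * m ^+ 2.
  by rewrite m2; ring.
have h1 : - (p * m * (1 - k)) <= p * a by rewrite -mulrA -mulrN ler_wpM2l.
have h2 : 0 <= (1 - k) * (1 - p * m) ^+ 2 by rewrite mulr_ge0 ?sqr_ge0 // subr_ge0.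
have h3 : k * (d * (1 + p ^+ 2)) <= k * (1 + p ^+ 2 * m ^+ 2).
  by rewrite ler_wpM2l ?(ltW k0) // mulrDr mulr1 lerD // mulrC ler_wpM2l // sqr_ge0.
have h4 : k * d * (1 + p) ^+ 2 <= k * d * (2 * (1 + p ^+ 2)).
  rewrite ler_wpM2l ?mulr_ge0 ?(ltW k0) ?(ltW d0) //.
  by have := sqr_ge0 (1 - p); rewrite !sqrrD sqrrN; lra.
move: h2; rewrite sqrrB; lra.
Qed.

(** The ray 1 + p Q in the logarithmic coordinate p = e^{-s}: a step t in s
    multiplies p by q = e^{-t}. *)
Definition raylog Q s : C := ray Q (expR (- s)).
(** Minus the derivative of Log (raylog Q s) with respect to s; at s = k t it is
    the k-th term of the logarithmic derivative of a theta product. *)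
Definition slope Q s : C := (expR (- s))%:C%C * Q / raylog Q s.

(** A bounded increasing function that controls the variation of the slope, so
    that the errors of all the steps of a Riemann sum telescope. *)
Let h s : R := (1 + expR (- s))^-1.

Let mvt_step (f df : R -> R) (K : R) s t : 0 < t ->
  (forall x : R, is_derive x (1 : R) f (df x)) ->
  (forall x, s <= x <= s + t -> `|df x - df s| <= K) ->
  `|f (s + t) - f s - t * df s| <= t * K.
Proof.
move=> t0 fd dfK.
have st : s <= s + t by rewrite lerDl ltW.
have cf : {within `[s, s + t], continuous f}.
  by apply: derivable_within_continuous => x _; exact: ex_derive.
have [x xI e] := MVT_segment st (fun x _ => fd x) cf.
rewrite e [s + t]addrC addrK mulrC -mulrBr normrM (gtr0_norm t0) ler_wpM2l ?(ltW t0) //.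
by apply: dfK; move: xI; rewrite in_itv.
Qed.

Let dexpN s : is_derive s (1 : R) (fun s => expR (- s)) (- expR (- s)).
Proof.
have d := is_derive1_comp (is_derive_expR (- s)) (is_deriveN (is_derive_id s (1 : R))).
by apply: (is_derive_eq d); rewrite mulrN1.
Qed.

Let slopeE Q s : slope Q s = (expR (- s))%:C%C * (Q / raylog Q s).
Proof. by rewrite mulrA. Qed.

Section Path.
Variable Q : C.
Hypothesis slitQ : ~~ (Q <= 0).

Let slit_raylog s : 0 < cabs (raylog Q s) + complex.Re (raylog Q s).
Proof. by rewrite slit_ray ?expR_ge0. Qed.

Lemma Log_raylog s : Log (raylog Q s) = Complex (ln (cabs (raylog Q s)))
  (2 * atan (complex.Im (raylog Q s) / (cabs (raylog Q s) + complex.Re (raylog Q s)))).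
Proof. by rewrite -Arg_atan. Qed.

Let dRe s : is_derive s (1 : R) (fun s => complex.Re (Log (raylog Q s)))
  (- complex.Re (slope Q s)).
Proof.
move: (slit_raylog s); rewrite slopeE Re_realM /raylog /ray; case: Q => a b sl.
have d := @is_derive1_comp R _ (fun s => expR (- s)) s _ _ (is_derive_ln_ray sl) (dexpN s).
by apply: (is_derive_eq d); rewrite mulrN mulrC.
Qed.

Let dIm s : is_derive s (1 : R) (fun s => complex.Im (Log (raylog Q s)))
  (- complex.Im (slope Q s)).
Proof.
have -> : (fun s => complex.Im (Log (raylog Q s))) = (fun s =>
    2 * atan (complex.Im (raylog Q s) / (cabs (raylog Q s) + complex.Re (raylog Q s)))).
  by apply/funext => x; rewrite Log_raylog.
move: (slit_raylog s); rewrite slopeE Im_realM /raylog /ray; case: Q => a b sl.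
have d := @is_derive1_comp R _ (fun s => expR (- s)) s _ _ (is_derive_arg_ray sl) (dexpN s).
by apply: (is_derive_eq d); rewrite mulrN mulrC.
Qed.

(** The difference is Q (p' - p) / ((1 + p Q) (1 + p' Q)); bounding the two
    denominators below by c (1 + p) and c (1 + p') leaves a difference of values
    of the bounded function. *)
Lemma slope_variation c s x t : 0 < c ->
  (forall p, 0 <= p -> c * (1 + p) <= cabs (ray Q p)) -> s <= x <= s + t ->
  cabs (slope Q x - slope Q s) <= cabs Q / c ^+ 2 * (h (s + t) - h s).
Proof.
move=> c0 lb /andP[sx xt].
have e0 (y : R) : 0 < expR (- y) by exact: expR_gt0.
have rn y : raylog Q y != 0 by rewrite ray_neq0 ?expR_ge0.
have dE : slope Q x - slope Q s =
    Q * (expR (- x) - expR (- s))%:C%C / (raylog Q x * raylog Q s).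
  rewrite /slope; apply: (mulIf (mulf_neq0 (rn x) (rn s))).
  rewrite [RHS]divfK ?mulf_neq0 // mulrBl mulrA divfK // [raylog Q x * _]mulrC mulrA divfK //.
  by rewrite /raylog /ray rmorphB /=; ring.
rewrite dE !Normc.normcM Normc.normcV Normc.normcM cabs_real -mulrA -[leRHS]mulrA.
apply: ler_wpM2l; first exact: cabs_ge0.
have ex : expR (- (s + t)) <= expR (- x) by rewrite ler_expR lerN2.
have es : expR (- x) <= expR (- s) by rewrite ler_expR lerN2.
have := lb _ (expR_ge0 (- x)); have := lb _ (expR_ge0 (- s)).
rewrite -/(raylog Q s) -/(raylog Q x) distrC ger0_norm ?subr_ge0 // /h.
move: (e0 s) (e0 x) (e0 (s + t)) ex es.
move: (cabs (raylog Q s)) (cabs (raylog Q x)) (expR (- s)) (expR (- x)) (expR (- (s + t))).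
move=> rs rx ps px pt ps0 px0 pt0 tx xs lbs lbx.
have s1 : 0 < 1 + ps by rewrite addr_gt0.
have x1 : 0 < 1 + px by rewrite addr_gt0.
have cs0 : 0 < c * (1 + ps) by rewrite mulr_gt0.
have cx0 : 0 < c * (1 + px) by rewrite mulr_gt0.
apply: (@le_trans _ _ ((ps - px) / ((c * (1 + px)) * (c * (1 + ps))))).
  rewrite ler_wpM2l ?subr_ge0 // lef_pV2 ?posrE.
  - by apply: ler_pM => //; exact: ltW.
  - by rewrite mulr_gt0 // (lt_le_trans _ lbx, lt_le_trans _ lbs).
  - by rewrite mulr_gt0.
have -> : (ps - px) / ((c * (1 + px)) * (c * (1 + ps))) =
    (c ^+ 2)^-1 * ((1 + px)^-1 - (1 + ps)^-1).
  by field; rewrite !gt_eqF // addr_gt0.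
rewrite ler_wpM2l ?invr_ge0 ?sqr_ge0 // lerD2r lef_pV2 ?posrE ?addr_gt0 //.
by rewrite lerD2l.
Qed.

Lemma Log_step c s t : 0 < c -> 0 < t ->
  (forall p, 0 <= p -> c * (1 + p) <= cabs (ray Q p)) ->
  cabs (Log (raylog Q s) - Log (raylog Q (s + t)) - t%:C%C * slope Q s) <=
    t * (2 * (cabs Q / c ^+ 2)) * (h (s + t) - h s).
Proof.
move=> c0 t0 lb; set K := cabs Q / c ^+ 2 * (h (s + t) - h s).
have var x : s <= x <= s + t -> cabs (slope Q x - slope Q s) <= K.
  exact: slope_variation.
have re : `|complex.Re (Log (raylog Q (s + t))) - complex.Re (Log (raylog Q s))
    - t * - complex.Re (slope Q s)| <= t * K.
  apply: (mvt_step t0 dRe) => x /var; apply: le_trans.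
  by rewrite -opprD normrN -complex_subE cabs_Re.
have im : `|complex.Im (Log (raylog Q (s + t))) - complex.Im (Log (raylog Q s))
    - t * - complex.Im (slope Q s)| <= t * K.
  apply: (mvt_step t0 dIm) => x /var; apply: le_trans.
  by rewrite -opprD normrN -complex_subE cabs_Im.
apply: le_trans (cabs_le_ReIm _) _.
rewrite !complex_subE Re_realM Im_realM.
have -> : t * (2 * (cabs Q / c ^+ 2)) * (h (s + t) - h s) = t * K + t * K by rewrite /K; ring.
apply: lerD; rewrite -normrN.
  apply: le_trans re; rewrite le_eqVlt; apply/orP; left; apply/eqP; congr `|_|; ring.
apply: le_trans im; rewrite le_eqVlt; apply/orP; left; apply/eqP; congr `|_|; ring.
Qed.

(** The error of the left Riemann sum is O(t) with a constant that depends neither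
    on the starting point nor on the number of steps: this uniformity allows
    n to go to infinity for fixed t. *)
Lemma Log_riemann_sum c s t n : 0 < c -> 0 < t ->
  (forall p, 0 <= p -> c * (1 + p) <= cabs (ray Q p)) ->
  cabs (Log (raylog Q s) - Log (raylog Q (s + t *+ n)) -
        t%:C%C * \sum_(k < n) slope Q (s + t *+ k)) <= t * (2 * (cabs Q / c ^+ 2)).
Proof.
move=> c0 t0 lb; set K := 2 * _.
have K0 : 0 <= t * K by rewrite mulr_ge0 ?(ltW t0) // mulr_ge0 // divr_ge0 ?cabs_ge0 ?sqr_ge0.
apply: (@le_trans _ _ (t * K * (h (s + t *+ n) - h s))); last first.
  rewrite ler_piMr // /h.
  have a := expR_gt0 (- s); have b := expR_gt0 (- (s + t *+ n)).
  have : (1 + expR (- (s + t *+ n)))^-1 <= 1 by rewrite invf_le1; lra.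
  have : 0 <= (1 + expR (- s))^-1 by rewrite invr_ge0; lra.
  lra.
elim: n => [|n IH].
  by rewrite big_ord0 mulr0n addr0 !subrr mulr0 subr0 Normc.normc0 mulr0.
have step := Log_step (s + t *+ n) c0 t0 lb.
have -> : s + t *+ n.+1 = s + t *+ n + t by rewrite mulrSr addrA.
rewrite big_ord_recr /=.
set u := slope _ _ in step *; set A := Log _ in IH *; set B := Log _ in IH step *.
set D := Log _ in step *; set S := \sum_(_ < _) _ in IH *.
have -> : A - D - t%:C%C * (S + u) = (A - B - t%:C%C * S) + (B - D - t%:C%C * u) by ring.
apply: le_trans (cabsD _ _) _; apply: le_trans (lerD IH step) _.
by rewrite -/K -mulrDr; apply: ler_wpM2l => //; lra.
Qed.

End Path.
End RiemannSum.

(** * The theta function and its derivative *)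

Section Theta.
Variable R : realType.
Local Notation C := R[i].
Local Notation cabs := (@Normc.normc R).

(** The quadratic exponent beats every geometric growth. The weight leaves room
    for termwise differentiation and for the second order remainder; it is at
    most 4^(n+m), which is absorbed into rho. *)
Lemma gaussian_series_cvg (q rho : R) (m : nat) : 0 < q < 1 -> 0 <= rho ->
  cvgn (series (fun n => (n + m).+1%:R ^+ 2 * (q ^+ 'C(n + m, 2) * rho ^+ (n + m)))).
Proof.
move=> /andP[q0 q1] rho0.
pose b n := q ^+ 'C(n + m, 2) * (4 * rho) ^+ (n + m).
have rho4 : 0 <= 4 * rho by rewrite mulr_ge0.
have b0 n : 0 <= b n by rewrite mulr_ge0 ?exprn_ge0 // ltW.
have cb : cvgn (series b).
  apply: (ratio_test (r := fun n => q ^+ (n + m) * (4 * rho)) (l := 0) b0) => //.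
  - move=> n; rewrite /b addSn binS bin1 exprD exprS.
    by rewrite le_eqVlt; apply/orP; left; apply/eqP; ring.
  - have -> : 0 = 0 * q ^+ m * (4 * rho) :> R by rewrite !mul0r.
    under eq_fun do rewrite exprD.
    apply: cvgM; last exact: cvg_cst.
    apply: cvgM; last exact: cvg_cst.
    by apply: cvg_expr; rewrite gtr0_norm.
apply: (series_le_cvg _ b0 _ cb) => n.
  by rewrite mulr_ge0 ?sqr_ge0 // mulr_ge0 ?exprn_ge0 // ltW.
rewrite /b exprMn mulrCA ler_wpM2l ?exprn_ge0 ?(ltW q0) //.
rewrite ler_wpM2r ?exprn_ge0 // -natrX -natrX ler_nat.
have -> : (4 ^ (n + m) = (2 ^ (n + m)) ^ 2)%N by rewrite -expnM mulnC expnM.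
by rewrite leq_exp2r // ltn_expl.
Qed.

(** By induction: passing from n to n+1 multiplies the remainder by w and adds
    n z^(n-1) (w - z)^2, and n^2 + n <= (n+1)^2. *)
Lemma taylor1_bound (z w : C) (rho : R) n : 1 <= rho ->
  cabs z <= rho -> cabs w <= rho ->
  cabs (w ^+ n - z ^+ n - (w - z) * (n%:R * z ^+ n.-1)) <=
    n%:R ^+ 2 * rho ^+ n * cabs (w - z) ^+ 2.
Proof.
move=> r1 zr wr; have r0 : 0 <= rho by apply: le_trans r1.
elim: n => [|n IH].
  by rewrite !expr0 subrr mul0r mulr0 subr0 Normc.normc0 expr0n !mul0r.
have -> : w ^+ n.+1 - z ^+ n.+1 - (w - z) * (n.+1%:R * z ^+ n) =
    w * (w ^+ n - z ^+ n - (w - z) * (n%:R * z ^+ n.-1)) +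
    n%:R * z ^+ n.-1 * (w - z) ^+ 2.
  case: n {IH} => [|n]; first by rewrite !expr1 !expr0; ring.
  by rewrite -[n.+2%:R]natr1 /= !exprS; ring.
apply: le_trans (cabsD _ _) _; rewrite !Normc.normcM !cabsX.
have cn : cabs n%:R = n%:R.
  by rewrite -[n%:R in LHS](rmorph_nat (real_complex R)) cabs_real normr_nat.
rewrite cn; apply: (@le_trans _ _
  ((n%:R ^+ 2 + n%:R) * rho ^+ n.+1 * cabs (w - z) ^+ 2)).
  have -> : (n%:R ^+ 2 + n%:R) * rho ^+ n.+1 * cabs (w - z) ^+ 2 = n%:R ^+ 2 *
      rho ^+ n.+1 * cabs (w - z) ^+ 2 + n%:R * rho ^+ n.+1 * cabs (w - z) ^+ 2 by ring.
  apply: lerD.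
    apply: (@le_trans _ _ (rho * (n%:R ^+ 2 * rho ^+ n * cabs (w - z) ^+ 2))).
      by apply: ler_pM; rewrite ?cabs_ge0.
    by rewrite le_eqVlt; apply/orP; left; apply/eqP; rewrite [rho ^+ n.+1]exprS; ring.
  rewrite ler_wpM2r ?sqr_ge0 // ler_wpM2l //.
  apply: (@le_trans _ _ (rho ^+ n.-1)).
    by apply: lerXn2r; rewrite ?nnegrE ?cabs_ge0.
  by rewrite ler_weXn2l // (leq_trans (leq_pred n)).
rewrite ler_wpM2r ?sqr_ge0 // ler_wpM2r ?exprn_ge0 //.
by rewrite -natr1 sqrrD; have : 0 <= n%:R :> R by []; lra.
Qed.

Lemma lim_seriesZl (f : nat -> C) (k : C) : cvgn (series f) ->
  limn (series (fun n => k * f n)) = k * limn (series f).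
Proof. by move=> cf; rewrite -[RHS](@lim_seriesZ C f k cf). Qed.

Lemma lim_series_bound (u : nat -> C) (b : nat -> R) :
  (forall d, cabs (u d) <= b d) -> cvgn (series b) ->
  cabs (limn (series u)) <= limn (series b).
Proof.
move=> ub cb; have := series_tail_bound 0 ub cb.
by rewrite /series /= !big_geq // !subr0.
Qed.

Section PowerSeries.
Variables (c : nat -> C) (m : nat).

(** The shift m is 0 for the terms of theta of nonnegative index and 1 for those
    of negative index, expanded in powers of q / z without constant term. *)
Definition pser (z : C) : C := limn (series (fun n => c n * z ^+ (n + m))).
Definition pser' (z : C) : C :=
  limn (series (fun n => c n * ((n + m)%:R * z ^+ (n + m).-1))).

Lemma pser_taylor1 (rho : R) : 1 <= rho ->
  cvgn (series (fun n => (n + m).+1%:R ^+ 2 * (cabs (c n) * rho ^+ (n + m)))) ->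
  exists2 M : R, 0 <= M & forall z w : C, cabs z <= rho -> cabs w <= rho ->
    cabs (pser w - pser z - (w - z) * pser' z) <= M * cabs (w - z) ^+ 2.
Proof.
move=> r1; set b := fun n => _ => cb.
have r0 : 0 <= rho by apply: le_trans r1.
have b0 n : 0 <= cabs (c n) * rho ^+ (n + m) by rewrite mulr_ge0 ?exprn_ge0 // cabs_ge0.
have dom (u : nat -> C) : (forall n, cabs (u n) <=
    (n + m).+1%:R ^+ 2 * (cabs (c n) * rho ^+ (n + m))) -> cvgn (series u).
  by move=> ub; exact: complex_series_cvg ub cb.
have cu x : cabs x <= rho -> cvgn (series (fun n => c n * x ^+ (n + m))).
  move=> xr; apply: dom => n; apply: (@le_trans _ _ (1 * (cabs (c n) * rho ^+ (n + m)))).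
    rewrite mul1r Normc.normcM ler_wpM2l ?cabs_ge0 // cabsX.
    by apply: lerXn2r; rewrite ?nnegrE ?cabs_ge0.
  by rewrite ler_wpM2r // -natrX ler1n expn_gt0.
have cd x : cabs x <= rho -> cvgn (series (fun n => c n * ((n + m)%:R * x ^+ (n + m).-1))).
  move=> xr; apply: dom => n; rewrite !Normc.normcM mulrCA; apply: ler_pM;
    rewrite ?mulr_ge0 ?cabs_ge0 //.
    rewrite -[(n + m)%:R](rmorph_nat (real_complex R)) cabs_real normr_nat.
    have := sqr_ge0 ((n + m)%:R : R); have : 0 <= (n + m)%:R :> R by [].
    by rewrite -natr1 sqrrD; lra.
  rewrite ler_wpM2l ?cabs_ge0 // cabsX; apply: (@le_trans _ _ (rho ^+ (n + m).-1)).
    by apply: lerXn2r; rewrite ?nnegrE ?cabs_ge0.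
  by rewrite ler_weXn2l // leq_pred.
exists (limn (series b)).
  have lb : cabs (limn (series (fun _ : nat => 0 : C))) <= limn (series b).
    apply: lim_series_bound cb => n.
    by rewrite Normc.normc0 mulr_ge0 ?sqr_ge0.
  exact: le_trans (cabs_ge0 _) lb.
move=> z w zr wr.
have -> : pser w - pser z - (w - z) * pser' z = limn (series (fun n =>
    c n * w ^+ (n + m) - c n * z ^+ (n + m)
     - (w - z) * (c n * ((n + m)%:R * z ^+ (n + m).-1)))).
  rewrite /pser /pser' -lim_seriesZl; last exact: cd.
  rewrite -(lim_seriesB (cu _ wr) (cu _ zr)) -lim_seriesB //.
    exact: is_cvg_seriesB (cu _ wr) (cu _ zr).
  exact: (@is_cvg_seriesZ C _ (w - z) (cd _ zr)).
rewrite mulrC; have -> : cabs (w - z) ^+ 2 * limn (series b) =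
   limn (series (fun n => cabs (w - z) ^+ 2 * b n)).
  by rewrite -[LHS](@lim_seriesZ R b (cabs (w - z) ^+ 2) cb).
apply: lim_series_bound; last exact: (@is_cvg_seriesZ R _ (cabs (w - z) ^+ 2) cb).
move=> n; have -> : c n * w ^+ (n + m) - c n * z ^+ (n + m) -
   (w - z) * (c n * ((n + m)%:R * z ^+ (n + m).-1)) =
   c n * (w ^+ (n + m) - z ^+ (n + m) - (w - z) * ((n + m)%:R * z ^+ (n + m).-1)) by ring.
rewrite Normc.normcM; apply: le_trans (ler_wpM2l (cabs_ge0 _) (taylor1_bound _ r1 zr wr)) _.
have -> : cabs (c n) * ((n + m)%:R ^+ 2 * rho ^+ (n + m) * cabs (w - z) ^+ 2) =
    cabs (w - z) ^+ 2 * ((n + m)%:R ^+ 2 * (cabs (c n) * rho ^+ (n + m))) by ring.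
rewrite /b ler_wpM2l ?sqr_ge0 // ler_wpM2r // -!natrX ler_nat leq_exp2r //.
Qed.

End PowerSeries.

Variable q : R.
Hypothesis q01 : 0 < q < 1.
Let qC : C := q%:C%C.

Definition gser (m : nat) (z : C) : C := pser (fun n => qC ^+ 'C(n + m, 2)) m z.
Definition gser' (m : nat) (z : C) : C := pser' (fun n => qC ^+ 'C(n + m, 2)) m z.

Let cabs_qX n : cabs (qC ^+ n) = q ^+ n.
Proof. by case/andP: q01 => q0 _; rewrite cabsX cabs_real gtr0_norm. Qed.

Lemma gser_cvg m (rho : R) : 0 <= rho -> cvgn (series (fun n =>
  (n + m).+1%:R ^+ 2 * (cabs (qC ^+ 'C(n + m, 2)) * rho ^+ (n + m)))).
Proof.
move=> r0; under eq_fun do rewrite cabs_qX.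
exact: gaussian_series_cvg.
Qed.

Lemma exprz_triangular (x : C) n : x ^ (((n%:Z * (n%:Z - 1))%R %/ 2)%Z) = x ^+ 'C(n, 2).
Proof.
suff -> : ((n%:Z * (n%:Z - 1))%R %/ 2)%Z = 'C(n, 2)%:Z by [].
have -> : n%:Z * (n%:Z - 1) = 'C(n, 2)%:Z * 2.
  rewrite -PoszM mulnC -(mul_bin_diag n 1) bin1 PoszM.
  by case: n => // n; rewrite -[n.+1%:Z - 1]/(n.+1%:Z - 1%N%:Z) subzn // subSS subn0.
by rewrite mulzK.
Qed.

(** For d = -(n+1) the exponent d(d-1)/2 is (n+2 choose 2), that is
    (n+1 choose 2) + (n+1); the extra power of q goes with z^-1. *)
Lemma theta_gser (z : C) : z != 0 -> theta qC z = gser 0 z + gser 1 (qC / z).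
Proof.
move=> z0; rewrite /theta /zsum /gser /pser; congr (limn (series _) + limn (series _)).
  by apply/funext => n; rewrite exprz_triangular addn0.
apply/funext => n.
have -> : Negz n * (Negz n - 1) = (n.+2)%:Z * (n.+2%:Z - 1).
  by rewrite NegzE !intS; ring.
rewrite exprz_triangular -[z ^ Negz n]/(z ^- n.+1) addn1 exprMn exprVn mulrA.
by rewrite -exprD binS bin1.
Qed.

(** Both halves of theta are power series with a quadratic first order remainder,
    one in z and one in q / z; the latter varies like - q h / z^2. *)
Lemma derive_theta (z : C) : z != 0 ->
  derive1 (theta qC) z = gser' 0 z - qC / z ^+ 2 * gser' 1 (qC / z).
Proof.
move=> z0; set D := (RHS).
have za : 0 < cabs z by rewrite cabs_gt0.
have /andP[q0 q1] := q01.
pose a := cabs z.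
(* A common bound for z, z + h, q / z and q / (z + h) when |h| <= |z| / 2. *)
pose rho := Num.max 1 (Num.max (2 * a) (2 * q / a)).
have r1 : 1 <= rho by rewrite le_max lexx.
have ra : 2 * a <= rho by rewrite !le_max lexx orbT.
have rq : 2 * q / a <= rho by rewrite !le_max lexx !orbT.
have r0 : 0 <= rho by apply: le_trans r1.
have [M0 M00 T0] := pser_taylor1 r1 (@gser_cvg 0%N rho r0).
have [M1 M10 T1] := pser_taylor1 r1 (@gser_cvg 1%N rho r0).
pose G := cabs (gser' 1 (qC / z)).
pose K := M0 + M1 * (2 * q / a ^+ 2) ^+ 2 + G * (2 * q / a ^+ 3).
have cq : cabs qC = q by rewrite cabs_real gtr0_norm.
have bound h : h != 0 -> cabs h <= a / 2 ->
    cabs (D - h^-1 * (theta qC (h + z) - theta qC z)) <= K * cabs h.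
  move=> h0 ha; set z' := h + z.
  have ch : 0 < cabs h by rewrite cabs_gt0.
  have z'a : a / 2 <= cabs z'.
    have := cabs_dist z (- h); rewrite opprK cabsN [z + h]addrC => /(le_trans (ler_norm _)).
    by rewrite -/a -/z'; lra.
  have z'A : cabs z' <= 3 / 2 * a.
    by apply: le_trans (cabsD _ _) _; rewrite -/a; lra.
  have z'p : 0 < cabs z' by apply: lt_le_trans z'a; rewrite divr_gt0.
  have z'0 : z' != 0 by rewrite -cabs_gt0.
  have cw x : cabs (qC / x) = q / cabs x by rewrite Normc.normcM Normc.normcV cq.
  have E0 := T0 z z' _ _; have E1 := T1 (qC / z) (qC / z') _ _.
  have {E0} E0 : cabs (gser 0 z' - gser 0 z - (z' - z) * gser' 0 z) <= M0 * cabs h ^+ 2.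
    have -> : cabs h = cabs (z' - z) by rewrite addrK.
    by apply: E0; rewrite -/a; lra.
  have dw : qC / z' - qC / z = - (qC * h / (z * z')).
    have -> : h = z' - z by rewrite addrK.
    by field; rewrite z0 z'0.
  have cdw : cabs (qC / z' - qC / z) <= 2 * q / a ^+ 2 * cabs h.
    rewrite dw cabsN !Normc.normcM Normc.normcV Normc.normcM cq -/a.
    rewrite ler_pdivrMr ?mulr_gt0 //.
    have -> : 2 * q / a ^+ 2 * cabs h * (a * cabs z') = q * cabs h * (cabs z' / (a / 2)).
      by field; rewrite gt_eqF.
    rewrite ler_peMr ?mulr_ge0 ?(ltW q0) ?cabs_ge0 // ler_pdivlMr ?mul1r // divr_gt0 //.
  have {E1} E1 : cabs (gser 1 (qC / z') - gser 1 (qC / z)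
      - (qC / z' - qC / z) * gser' 1 (qC / z)) <= M1 * (2 * q / a ^+ 2 * cabs h) ^+ 2.
    apply: le_trans (E1 _ _) _; last first.
    - apply: ler_wpM2l => //; apply: lerXn2r; rewrite ?nnegrE ?cabs_ge0 //.
      exact: le_trans (cabs_ge0 _) cdw.
    - rewrite cw; apply: le_trans rq; rewrite ler_pdivrMr //.
      have -> : 2 * q / a * cabs z' = q * (cabs z' / (a / 2)) by field; rewrite gt_eqF.
      by rewrite ler_peMr ?(ltW q0) // ler_pdivlMr ?mul1r // divr_gt0.
    - rewrite cw; apply: le_trans rq; rewrite -/a ler_pM2r ?invr_gt0 //; lra.
  rewrite cabsB !theta_gser //.
  have -> : h^-1 * (gser 0 z' + gser 1 (qC / z') - (gser 0 z + gser 1 (qC / z))) - D =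
    h^-1 * ((gser 0 z' - gser 0 z - (z' - z) * gser' 0 z) +
     (gser 1 (qC / z') - gser 1 (qC / z) - (qC / z' - qC / z) * gser' 1 (qC / z)) +
     qC * h ^+ 2 / (z ^+ 2 * z') * gser' 1 (qC / z)).
    rewrite /D dw; have -> : z' - z = h by rewrite addrK.
    have e : z' = h + z by [].
    move: (gser _ _) (gser _ _) (gser _ _) (gser _ _) (gser' _ _) (gser' _ _) => *.
    rewrite e; field; rewrite -e z'0 z0 h0 //.
  rewrite Normc.normcM Normc.normcV mulrC ler_pdivrMr //.
  apply: le_trans (cabsD _ _) _.
  apply: le_trans (lerD (le_trans (cabsD _ _) (lerD E0 E1)) (lexx _)) _.
  have -> : K * cabs h * cabs h = M0 * cabs h ^+ 2 + M1 * (2 * q / a ^+ 2 * cabs h) ^+ 2 +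
     2 * q / a ^+ 3 * cabs h ^+ 2 * G by rewrite /K; ring.
  rewrite lerD2l Normc.normcM ler_wpM2r ?cabs_ge0 //.
  rewrite !Normc.normcM Normc.normcV Normc.normcM !cabsX cq -/a.
  rewrite ler_pdivrMr ?mulr_gt0 ?exprn_gt0 //.
  have -> : 2 * q / a ^+ 3 * cabs h ^+ 2 * (a ^+ 2 * cabs z') =
    q * cabs h ^+ 2 * (cabs z' / (a / 2)) by field; rewrite gt_eqF.
  apply: ler_peMr; first by rewrite mulr_ge0 ?sqr_ge0 // ltW.
  by rewrite ler_pdivlMr ?mul1r // divr_gt0.
have h0 : cabs h @[h --> (0 : C)^'] --> (0 : R).
  rewrite -[X in _ --> X](Normc.normc0 R); apply: cvg_cabs.
  exact: cvg_within_filter.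
apply: cvg_lim => //; apply: (cvgC_bound (g := fun h => K * cabs h)).
  near=> h; apply: bound; first by near: h; exact: nbhs_dnbhs_neq.
  by near: h; apply: (cvgr_le _ h0); rewrite divr_gt0.
have -> : 0 = K * 0 :> R by rewrite mulr0.
by apply: cvgM; [exact: cvg_cst|exact: h0].
Unshelve. all: by end_near. Qed.

End Theta.

(** * The finite Jacobi triple product *)

Section Rothe.
Variables (F : fieldType) (q : F).

Definition qfact n : F := \prod_(k < n) (1 - q ^+ k.+1).
(** The Gaussian binomial coefficient, for j <= n. *)
Definition qbinom n j : F := qfact n / (qfact j * qfact (n - j)).

Lemma qfact0 : qfact 0 = 1. Proof. by rewrite /qfact big_ord0. Qed.

Lemma qfactS n : qfact n.+1 = qfact n * (1 - q ^+ n.+1).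
Proof. by rewrite /qfact big_ord_recr. Qed.

Hypothesis q_aperiodic : forall n, 1 - q ^+ n.+1 != 0.

Lemma qfact_neq0 n : qfact n != 0.
Proof. by apply/prodf_neq0 => k _. Qed.

(** Rothe's q-binomial theorem. Multiplying by 1 + q^n X acts on the coefficients
    by the q-Pascal rule. *)
Lemma rothe n : \prod_(k < n) (1 + q ^+ k *: 'X) =
  \poly_(j < n.+1) (qbinom n j * q ^+ 'C(j, 2)) :> {poly F}.
Proof.
have f0 := qfact_neq0.
elim: n => [|n IH].
  rewrite big_ord0; apply/polyP => -[|j]; rewrite coef_poly coef1 //=.
  by rewrite /qbinom subnn qfact0 expr0 !mulr1 invr1 mulr1.
rewrite big_ord_recr /= IH mulrDr mulr1 -scalerAr.
apply/polyP => -[|j]; rewrite coefD coefZ coefMX !coef_poly /=.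
  by rewrite mulr0 addr0 /qbinom !subn0 qfact0 !mul1r !divff //; exact: f0.
rewrite !ltnS; have [jn|] := ltnP j n; last first.
  rewrite leq_eqVlt => /predU1P[<-|nj]; last by rewrite leqNgt nj /= mulr0 addr0.
  rewrite leqnn add0r /qbinom !subnn qfact0 !mulr1 !divff ?f0 //.
  by rewrite !mul1r binS bin1 exprD mulrC.
rewrite (ltnW jn) -(subnKC jn) /qbinom.
set m := (n - j.+1)%N.
rewrite addKn !addSn subSS.
have -> : ((j + m).+1 - j = m.+1)%N by rewrite -addnS addKn.
rewrite !qfactS binS bin1 !exprD !exprS !exprD.
have := (q_aperiodic j, q_aperiodic m); rewrite !exprS => -[a b].
have := (f0 j, f0 m, f0 (j + m)%N) => -[[fj fm] fjm].
by field; rewrite a b fj fm.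
Qed.

Lemma log_deriv_prod n x : (forall k, 1 + q ^+ k * x != 0) ->
  (\prod_(k < n) (1 + q ^+ k *: 'X))^`().[x] =
  (\prod_(k < n) (1 + q ^+ k *: 'X)).[x] * \sum_(k < n) q ^+ k / (1 + q ^+ k * x).
Proof.
move=> nz; elim: n => [|n IH].
  by rewrite !big_ord0 mulr0 -[1]/(1%:P) derivC horner0.
rewrite !big_ord_recr /= derivM derivD derivZ derivX -[1]/(1%:P) derivC add0r.
rewrite hornerD !hornerM IH hornerD !hornerZ hornerX !hornerC.
by have := nz n; move=> ?; field.
Qed.

Lemma bin2D m n : ('C(m + n, 2) = 'C(m, 2) + 'C(n, 2) + m * n)%N.
Proof.
elim: n => [|n IH]; first by rewrite muln0 !addn0.
by rewrite addnS binS bin1 IH ['C(n.+1, 2)]binS bin1 mulnS; ring.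
Qed.

Lemma bin2_sqr n : ('C(n, 2) + 'C(n.+1, 2) = n * n)%N.
Proof.
elim: n => // n IH; rewrite binS bin1 in IH.
rewrite ['C(n.+2, 2)]binS bin1 ['C(n.+1, 2)]binS bin1.
have -> : ('C(n, 2) + n + ('C(n, 2) + n + n.+1) =
  'C(n, 2) + ('C(n, 2) + n) + (n + n.+1))%N by ring.
by rewrite IH; ring.
Qed.

Section TwoSided.
Variables (Q : F) (N : nat).
Hypotheses (q0 : q != 0) (Q0 : Q != 0).
(** At x = Q q^{-N} the 2N factors of Rothe's product become 1 + Q q^d with
    -N <= d < N, and U is the monomial that recentres the expansion there. *)
Let x := Q / q ^+ N.
Let U := Q ^+ N / q ^+ 'C(N.+1, 2).

(** The coefficients of index d = i and d = -(i+1) of the recentred expansion, the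
    latter with respect to (q / Q)^(i+1). *)
Definition wplus i := qbinom (N + N) (N + i) * q ^+ 'C(i, 2).
Definition wminus i := qbinom (N + N) (N - i.+1) * q ^+ 'C(i.+1, 2).

Lemma split_sum (a : nat -> F) : \sum_(j < (N + N).+1) a j =
  \sum_(i < N.+1) a (N + i)%N + \sum_(i < N) a (N - i.+1)%N.
Proof.
rewrite -addnS big_split_ord /= addrC; congr (_ + _).
by rewrite (reindex_inj rev_ord_inj).
Qed.

Lemma wplusE i : qbinom (N + N) (N + i) * q ^+ 'C(N + i, 2) * x ^+ (N + i) =
  U * (wplus i * Q ^+ i).
Proof.
have e : q ^+ 'C(N + i, 2) * q ^+ 'C(N.+1, 2) = q ^+ 'C(i, 2) * q ^+ (N * (N + i)).
  by rewrite -!exprD; congr (_ ^+ _); rewrite bin2D mulnDr -bin2_sqr; ring.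
rewrite /wplus /U /x exprMn exprVn -exprM [Q ^+ (N + i)]exprD.
have qn n : q ^+ n != 0 by rewrite expf_neq0.
apply: (mulIf (qn (N * (N + i))%N)); apply: (mulIf (qn 'C(N.+1, 2))).
move: e (qn (N * (N + i))%N) (qn 'C(N.+1, 2)).
move: (q ^+ (N * (N + i))) (q ^+ 'C(N.+1, 2)) (q ^+ 'C(i, 2)) (q ^+ 'C(N + i, 2)) (qbinom _ _).
move=> a b c d g e a0 b0.
have -> : g * d * (Q ^+ N * Q ^+ i / a) * a * b = g * (d * b) * (Q ^+ N * Q ^+ i) by field.
by rewrite e; field.
Qed.

Lemma wminusE i : (i < N)%N ->
  qbinom (N + N) (N - i.+1) * q ^+ 'C(N - i.+1, 2) * x ^+ (N - i.+1) =
  U * (wminus i * (q / Q) ^+ i.+1).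
Proof.
move=> iN; set j := (N - i.+1)%N.
have jN : (j + i.+1 = N)%N by rewrite subnK.
have e : q ^+ 'C(j, 2) * q ^+ 'C(N.+1, 2) = q ^+ 'C(i.+1, 2) * q ^+ i.+1 * q ^+ (N * j).
  rewrite -!exprD; congr (_ ^+ _).
  have h : ('C(j, 2) + ('C(j, 2) + j) = j * j)%N by rewrite -bin2_sqr binS bin1.
  rewrite -jN -addnS bin2D ['C(i.+2, 2)]binS bin1.
  have -> : ('C(j, 2) + ('C(j, 2) + ('C(i.+1, 2) + i.+1) + j * i.+2) =
     'C(j, 2) + ('C(j, 2) + j) + ('C(i.+1, 2) + i.+1 + j * i.+1))%N.
    by rewrite [(j * i.+2)%N]mulnS; ring.
  by rewrite h; ring.
have qn n : q ^+ n != 0 by rewrite expf_neq0.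
have Qn n : Q ^+ n != 0 by rewrite expf_neq0.
have QN : Q ^+ N = Q ^+ j * Q ^+ i.+1 by rewrite -exprD jN.
rewrite /wminus -/j /U /x !expr_div_n -exprM QN.
move: e (Qn i.+1) (qn (N * j)%N) (qn 'C(N.+1, 2)) {QN}.
move: (q ^+ (N * j)) (q ^+ 'C(N.+1, 2)) (q ^+ 'C(i.+1, 2)) (q ^+ 'C(j, 2)) (qbinom _ _).
move: (q ^+ i.+1) (Q ^+ i.+1) (Q ^+ j) => qi Qi Qj.
move=> a b c d g e Qi0 a0 b0.
apply: (mulIf a0); apply: (mulIf b0).
have -> : g * d * (Qj / a) * a * b = g * (d * b) * Qj by field.
by rewrite e; field; rewrite Qi0 b0.
Qed.

Let U_neq0 : U != 0.
Proof. by rewrite mulf_neq0 ?invr_eq0 ?expf_neq0. Qed.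

(** A truncation of theta in which the coefficients are weighted by Gaussian
    binomials. *)
Definition jacobi_sum := \sum_(i < N.+1) wplus i * Q ^+ i +
  \sum_(i < N) wminus i * (q / Q) ^+ i.+1.

(** The same truncation of the image of theta under Q d/dQ. *)
Definition jacobi_sum' := \sum_(i < N.+1) wplus i * (i%:R * Q ^+ i) -
  \sum_(i < N) wminus i * (i.+1%:R * (q / Q) ^+ i.+1).

Let horner_rothe : (\prod_(k < N + N) (1 + q ^+ k *: 'X)).[x] = U * jacobi_sum.
Proof.
rewrite rothe horner_poly (split_sum (fun j => qbinom _ j * q ^+ 'C(j, 2) * x ^+ j)).
rewrite mulrDr !mulr_sumr; congr (_ + _); apply: eq_bigr => i _.
  exact: wplusE.
exact: wminusE.
Qed.

Let horner_rothe' : x * (\prod_(k < N + N) (1 + q ^+ k *: 'X))^`().[x] =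
  U * (jacobi_sum' + N%:R * jacobi_sum).
Proof.
rewrite rothe poly_def raddf_sum horner_sum mulr_sumr.
have -> : \sum_(j < (N + N).+1) x * ((qbinom (N + N) j * q ^+ 'C(j, 2)) *: 'X^j)^`().[x] =
    \sum_(j < (N + N).+1) j%:R * (qbinom (N + N) j * q ^+ 'C(j, 2) * x ^+ j).
  apply: eq_bigr => -[j _] _ /=; rewrite derivZ derivXn hornerZ hornerMn hornerXn.
  by case: j => [|j]; rewrite ?mulr0n ?mul0r ?mulr0 // exprS -mulr_natr; ring.
rewrite (split_sum (fun j => j%:R * (qbinom _ j * q ^+ 'C(j, 2) * x ^+ j))).
have -> p p' m m' : U * ((p' - m') + N%:R * (p + m)) =
    U * (p' + N%:R * p) + U * (N%:R * m - m') by ring.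
congr (_ + _); rewrite mulr_sumr -?sumrB -?big_split mulr_sumr /=;
  apply: eq_bigr => i _; rewrite ?wplusE ?wminusE //.
  by rewrite natrD; ring.
by rewrite natrB //; ring.
Qed.

(** The finite form of the Jacobi triple product: evaluate Rothe's formula at x;
    the N factors with d < 0 give (1 + q^{-d} / Q) times a monomial, and the
    product of these monomials is U. *)
Lemma jacobi_product : jacobi_sum =
  \prod_(k < N) (1 + Q * q ^+ k) * \prod_(k < N) (1 + Q^-1 * q ^+ k.+1).
Proof.
apply: (mulfI U_neq0); rewrite -horner_rothe horner_prod.
rewrite big_split_ord /= mulrCA [LHS]mulrC; congr (_ * _).
  apply: eq_bigr => k _; rewrite hornerD hornerZ hornerX hornerC exprD /x.
  by field; rewrite expf_neq0.
rewrite (reindex_inj rev_ord_inj) /=.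
have -> : U = \prod_(k < N) (Q / q ^+ k.+1).
  rewrite /U big_split /= prodr_const card_ord; congr (_ * _).
  elim: N => [|n IH]; first by rewrite big_ord0 expr0 invr1.
  rewrite binS bin1 big_ord_recr /= -IH exprD.
  by rewrite invfM.
rewrite -big_split /=; apply: eq_bigr => k _.
rewrite hornerD hornerZ hornerX hornerC /x.
have -> : q ^+ N = q ^+ (N - k.+1) * q ^+ k.+1 by rewrite -exprD subnK.
by field; rewrite Q0 !expf_neq0.
Qed.

(** Apply x d/dx to Rothe's formula: the product side gives a logarithmic
    derivative, and recentring by U turns the index j into d = j - N. *)
Lemma jacobi_log_deriv : (forall k, 1 + q ^+ k * (Q / q ^+ N) != 0) ->
  jacobi_sum' = jacobi_sum *
   (\sum_(k < N + N) (q ^+ k * (Q / q ^+ N)) / (1 + q ^+ k * (Q / q ^+ N)) - N%:R).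
Proof.
move=> nz; apply: (mulfI U_neq0); have e := log_deriv_prod (N + N) nz.
have h := horner_rothe'; rewrite -/x in nz e *; rewrite e horner_rothe in h.
have -> : \sum_(k < N + N) q ^+ k * x / (1 + q ^+ k * x) =
    x * \sum_(k < N + N) q ^+ k / (1 + q ^+ k * x).
  by rewrite mulr_sumr; apply: eq_bigr => k _; ring.
set S := \sum_(k < _) _ in h *.
have -> : U * jacobi_sum' = U * (jacobi_sum' + N%:R * jacobi_sum) - U * (N%:R * jacobi_sum) by ring.
by rewrite -h; ring.
Qed.

End TwoSided.
End Rothe.

(** * The logarithmic derivative of theta as a limit of finite sums *)

Section JacobiLimit.
Variable R : realType.
Local Notation C := R[i].
Local Notation cabs := (@Normc.normc R).
Variable q : R.
Hypothesis q01 : 0 < q < 1.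
Let qC : C := q%:C%C.

Lemma lim_finite_series (u : nat -> C) n :
  (forall i, (n <= i)%N -> u i = 0) -> limn (series u) = \sum_(i < n) u i.
Proof.
move=> u0; apply: lim_near_cst => //; exists n => // m /= nm.
rewrite /series /= (big_cat_nat _ nm) //= big_mkord.
rewrite [X in _ + X]big_nat_cond [X in _ + X]big1 ?addr0 //.
by move=> i /andP[/andP[/u0]].
Qed.

Let q_gt0 : 0 < q. Proof. by case/andP: q01. Qed.
Let q_lt1 : q < 1. Proof. by case/andP: q01. Qed.

Let cabs_qX n : cabs (qC ^+ n) = q ^+ n.
Proof. by rewrite cabsX cabs_real gtr0_norm. Qed.

(** With y = z q^k, from |1 + y| >= c follows |1 + y| (1 + |y| / c) >= 1, hence
    |1 + y| >= exp (- |y| / c), and the exponents form a convergent geometric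
    series. *)
Lemma prod_lower_bound (z : C) (c : R) n : 0 < c ->
  (forall k, c <= cabs (1 + z * qC ^+ k)) ->
  expR (- (cabs z / (c * (1 - q)))) <= cabs (\prod_(k < n) (1 + z * qC ^+ k)).
Proof.
move=> c0 cz; rewrite cabs_prod.
apply: (@le_trans _ _ (\prod_(k < n) expR (- (cabs z * q ^+ k / c)))).
  rewrite -expR_sum ler_expR sumrN lerN2.
  have -> : \sum_(k < n) cabs z * q ^+ k / c = cabs z / c * \sum_(k < n) q ^+ k.
    by rewrite mulr_sumr; apply: eq_bigr => k _; rewrite mulrAC.
  rewrite invfM mulrA; apply: ler_wpM2l; first by rewrite divr_ge0 ?cabs_ge0 // ltW.
  have := subrX1 q n; have : 0 <= q ^+ n by rewrite exprn_ge0 // ltW.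
  move: (q ^+ n) (\sum_(_ < _) _) => qn s qn0 e.
  rewrite -[leRHS]mul1r ler_pdivlMr ?subr_gt0 //; lra.
apply: ler_prod => k _; rewrite expR_ge0 /=.
have y0 : 0 <= cabs z * q ^+ k / c.
  by rewrite divr_ge0 ?(ltW c0) // mulr_ge0 ?cabs_ge0 // exprn_ge0 // ltW.
apply: (@le_trans _ _ (1 + cabs z * q ^+ k / c)^-1).
  by rewrite expRN lef_pV2 ?posrE ?expR_gt0 ?expR_ge1Dx //; lra.
rewrite -[leLHS]mul1r ler_pdivrMr; last lra.
rewrite mulrDr mulr1.
have h : cabs z * q ^+ k <= cabs (1 + z * qC ^+ k) * (cabs z * q ^+ k / c).
  rewrite mulrCA ler_peMr ?mulr_ge0 ?cabs_ge0 ?exprn_ge0 ?(ltW q_gt0) //.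
  by rewrite ler_pdivlMr // mul1r.
apply: le_trans (lerD (lexx _) h).
have := cabsD (1 + z * qC ^+ k) (- (z * qC ^+ k)).
by rewrite addrK Normc.normc1 cabsN Normc.normcM cabs_qX.
Qed.

Lemma qfact_real n : qfact qC n = (qfact q n)%:C%C.
Proof.
by rewrite rmorph_prod; apply: eq_bigr => k _; rewrite rmorphB rmorphXn rmorph1.
Qed.

(** The q-factorial is itself such a product, with z = -q and c = 1 - q. *)
Lemma qfact_bounds : exists2 c, 0 < c & forall n, c <= qfact q n <= 1.
Proof.
have f0 k : 0 <= 1 - q ^+ k.+1 by rewrite subr_ge0 exprn_ile1 // ltW.
exists (expR (- (cabs (- qC) / ((1 - q) * (1 - q))))); first exact: expR_gt0.
move=> n; apply/andP; split; last first.
  by apply: prodr_ile1 => k _; rewrite f0 /= gerBl exprn_ge0 // ltW.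
have -> : qfact q n = cabs (\prod_(k < n) (1 + - qC * qC ^+ k)).
  have -> : \prod_(k < n) (1 + - qC * qC ^+ k) = qfact qC n.
    by apply: eq_bigr => k _; rewrite mulNr -exprS.
  by rewrite qfact_real cabs_real ger0_norm // prodr_ge0.
apply: prod_lower_bound => [|k]; first by rewrite subr_gt0.
rewrite mulNr -exprS -rmorphXn -(rmorph1 (real_complex R)) -rmorphB cabs_real ger0_norm //.
by rewrite lerD2l lerN2 exprS ger_pMr // exprn_ile1 // ltW.
Qed.

Lemma cvg_qfact : exists2 L : R, 0 < L & qfact q n @[n --> \oo] --> L.
Proof.
have [c c0 cq] := qfact_bounds.
have cv : cvgn (qfact q).
  apply: nonincreasing_is_cvgn; last by exists c => _ [n _ <-]; case/andP: (cq n).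
  apply/nonincreasing_seqP => n; rewrite qfactS ger_pMr.
    by rewrite gerBl exprn_ge0 // ltW.
  by apply: lt_le_trans c0 _; case/andP: (cq n).
exists (limn (qfact q)) => //; apply: lt_le_trans c0 _.
apply: limr_ge => //; apply: nearW => n; by case/andP: (cq n).
Qed.

Let central N k := qbinom qC (N + N) (N + k).

(** The Gaussian binomials near the centre of row 2N are ratios of q-factorials,
    so they are bounded and tend to 1/L; dominated convergence applies. *)
Lemma central_series_cvg (L : R) m (e : nat -> C) (y : R) : 0 < L ->
  qfact q n @[n --> \oo] --> L -> 0 <= y ->
  (forall i, cabs (e i) <= (i + m).+1%:R ^+ 2 * y ^+ (i + m)) ->
  \sum_(i < N.+1 - m) central N (i + m) * qC ^+ 'C(i + m, 2) * e i @[N --> \oo] -->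
    L^-1%:C%C * limn (series (fun i => qC ^+ 'C(i + m, 2) * e i)).
Proof.
move=> L0 qL y0 ey; have [c c0 cq] := qfact_bounds.
have qf n : 0 < qfact q n by apply: lt_le_trans c0 _; case/andP: (cq n).
have bE i : cabs (qC ^+ 'C(i + m, 2) * e i) <=
    (i + m).+1%:R ^+ 2 * (q ^+ 'C(i + m, 2) * y ^+ (i + m)).
  by rewrite Normc.normcM cabs_qX mulrCA ler_wpM2l // exprn_ge0 // ltW.
have gs := gaussian_series_cvg (m := m) q01 y0.
rewrite -lim_seriesZl; last exact: complex_series_cvg bE gs.

pose u N i := if (i + m <= N)%N then central N (i + m) * qC ^+ 'C(i + m, 2) * e i else 0.
have uE N : \sum_(i < N.+1 - m) central N (i + m) * qC ^+ 'C(i + m, 2) * e i =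
    limn (series (u N)).
  rewrite (@lim_finite_series _ (N.+1 - m)); last first.
    by move=> i; rewrite leq_subLR addnC /u ltnNge => /negPf ->.
  apply: eq_bigr => i _; have := ltn_ord i.
  by rewrite ltn_subRL ltnS addnC /u => ->.
under eq_fun do rewrite uE.
have centralE N k : (k <= N)%N ->
    central N k = (qfact q (N + N) / (qfact q (N + k) * qfact q (N - k)))%:C%C.
  move=> kN; rewrite /central /qbinom subnDl !qfact_real.
  by rewrite -rmorphM -fmorph_div.
have sb : cvgn (series (fun i => (c ^+ 2)^-1 *
    ((i + m).+1%:R ^+ 2 * (q ^+ 'C(i + m, 2) * y ^+ (i + m))))).
  exact: (@is_cvg_seriesZ R _ (c ^+ 2)^-1 gs).
apply: (tannery sb).
- move=> i; have h : (qfact q (N + N) / (qfact q (N + (i + m)) * qfact q (N - (i + m))))%:C%C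
      * (qC ^+ 'C(i + m, 2) * e i) @[N --> \oo] -->
      (L / (L * L))%:C%C * (qC ^+ 'C(i + m, 2) * e i).
    apply: cvgM; last exact: cvg_cst.
    have sub (f : nat -> nat) : (forall A, \forall N \near \oo, (A <= f N)%N) ->
        qfact q (f N) @[N --> \oo] --> L.
      move=> fy; apply/cvgrPdist_lt => r r0.
      have /cvgrPdist_lt/(_ r r0)[A _ qA] := qL.
      by apply: filterS (fy A) => N fN; exact: qA.
    apply: cvg_real_complex; apply: cvgM.
      apply: sub => A; exists A => // N /= AN; exact: leq_trans AN (leq_addr _ _).
    apply: cvgV; first by rewrite mulf_neq0 // gt_eqF.
    apply: cvgM; apply: sub => A.
      by exists A => // N /= AN; exact: leq_trans AN (leq_addr _ _).
    by exists (A + (i + m))%N => // N /= AN; rewrite -(addnK (i + m)%N A) leq_sub2r.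
  rewrite (_ : L^-1 = L / (L * L)); last by field; rewrite gt_eqF.
  apply: cvg_trans h; apply: near_eq_cvg; near=> N.
  have kN : (i + m <= N)%N by near: N; exact: nbhs_infty_ge.
  by rewrite /u kN centralE // mulrA.
- apply: nearW => N i; rewrite /u; case: ifP => [kN|_]; last first.
    rewrite Normc.normc0 mulr_ge0 ?invr_ge0 ?sqr_ge0 // (le_trans (cabs_ge0 _) (bE i)) //.
  rewrite -mulrA Normc.normcM; apply: ler_pM; rewrite ?cabs_ge0 //.
  rewrite centralE // cabs_real ger0_norm; last by rewrite divr_ge0 ?mulr_ge0 // ltW.
  rewrite -[leRHS]mul1r; apply: ler_pM => //.
  - exact: ltW.
  - by rewrite invr_ge0 mulr_ge0 // ltW.
  - by case/andP: (cq (N + N)%N).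
  - rewrite lef_pV2 ?posrE ?mulr_gt0 ?exprn_gt0 // expr2; apply: ler_pM;
      rewrite ?(ltW c0) //.
    + by case/andP: (cq (N + (i + m))%N).
    + by case/andP: (cq (N - (i + m))%N).
Unshelve. all: by end_near. Qed.

(** Both halves of the truncated sums, written uniformly: m = 0 with z = Q and
    m = 1 with z = q / Q. *)
Let S m (z : C) N :=
  \sum_(i < N.+1 - m) central N (i + m) * qC ^+ 'C(i + m, 2) * z ^+ (i + m).
Let S' m (z : C) N := \sum_(i < N.+1 - m)
  central N (i + m) * qC ^+ 'C(i + m, 2) * ((i + m)%:R * z ^+ (i + m)).

Section Limits.
Variables (L : R) (m : nat) (z : C).
Hypotheses (L0 : 0 < L) (qL : qfact q n @[n --> \oo] --> L).
Let y := Num.max 1 (cabs z).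

Let y1 : 1 <= y. Proof. by rewrite le_max lexx. Qed.
Let y0 : 0 <= y. Proof. by apply: le_trans y1. Qed.

Let zy n : cabs (z ^+ n) <= y ^+ n.
Proof.
rewrite cabsX; apply: lerXn2r; rewrite ?nnegrE ?cabs_ge0 //.
by rewrite le_max lexx orbT.
Qed.

Let natC_le (n : nat) : cabs n%:R <= n.+1%:R ^+ 2.
Proof.
rewrite -[X in cabs X](rmorph_nat (real_complex R)) cabs_real normr_nat.
by rewrite -natr1 sqrrD; have := sqr_ge0 (n%:R : R); have : 0 <= n%:R :> R by []; lra.
Qed.

Lemma cvg_S : S m z N @[N --> \oo] --> L^-1%:C%C * gser q m z.
Proof.
apply: (central_series_cvg (e := fun i => z ^+ (i + m)) L0 qL y0) => i.
by rewrite -[leLHS]mul1r; apply: ler_pM; rewrite ?cabs_ge0 // -natrX ler1n expn_gt0.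
Qed.

Lemma cvg_S' : S' m z N @[N --> \oo] --> L^-1%:C%C * (z * gser' q m z).
Proof.
have -> : z * gser' q m z =
    limn (series (fun i => qC ^+ 'C(i + m, 2) * ((i + m)%:R * z ^+ (i + m)))).
  rewrite /gser' /pser' -lim_seriesZl; last first.
    apply: complex_series_cvg (gaussian_series_cvg (m := m) q01 y0) => i.
    rewrite Normc.normcM cabs_qX mulrCA ler_wpM2l ?exprn_ge0 ?(ltW q_gt0) //.
    rewrite Normc.normcM; apply: ler_pM; rewrite ?cabs_ge0 //.
    by apply: le_trans (zy _) _; rewrite ler_weXn2l // leq_pred.
  congr (limn (series _)); apply/funext => i.
  by case: (i + m)%N => [|k]; rewrite ?mul0r ?mulr0 // exprS /=; ring.
apply: (central_series_cvg (e := fun i => (i + m)%:R * z ^+ (i + m)) L0 qL y0) => i.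
by rewrite Normc.normcM; apply: ler_pM; rewrite ?cabs_ge0.
Qed.

End Limits.

Let qC_aperiodic n : 1 - qC ^+ n.+1 != 0.
Proof.
rewrite -rmorphXn -(rmorph1 (real_complex R)) -rmorphB fmorph_eq0 subr_eq0 eq_sym.
by rewrite lt_eqF // exprn_ilt1 // ltW.
Qed.

Variable Q : C.
Hypothesis slitQ : ~~ (Q <= 0).

Let Q0 : Q != 0. Proof. by apply: contraNneq slitQ => ->. Qed.
Let qC0 : qC != 0. Proof. by rewrite fmorph_eq0 gt_eqF. Qed.

Let wminus_central N (i : 'I_N) :
  wminus qC N i = central N i.+1 * qC ^+ 'C(i.+1, 2).
Proof.
have iN := ltn_ord i; rewrite /wminus /central /qbinom subnDl.
have -> : (N + N - (N - i.+1) = N + i.+1)%N by rewrite -addnBA ?leq_subr // subKn.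
by rewrite [X in _ / X]mulrC.
Qed.

Let jacobi_sumE N : jacobi_sum qC Q N = S 0 Q N + S 1 (qC / Q) N.
Proof.
rewrite /jacobi_sum /S subn0 subn1 /=; congr (_ + _); apply: eq_bigr => i _.
  by rewrite !addn0.
by rewrite !addn1 wminus_central.
Qed.

Let jacobi_sum_derivE N : jacobi_sum' qC Q N = S' 0 Q N - S' 1 (qC / Q) N.
Proof.
rewrite /jacobi_sum' /S' subn0 subn1 /=; congr (_ - _); apply: eq_bigr => i _.
  by rewrite !addn0.
by rewrite !addn1 wminus_central.
Qed.

(** Both truncated sums converge, to theta and to Q theta' up to the factor 1/L,
    and their ratio is the finite logarithmic derivative. The triple product
    bounds the truncated theta away from 0, so theta does not vanish at Q and
    the ratio converges to Q theta' / theta = - ell. *)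
Lemma cvg_log_deriv_theta :
  (\sum_(k < N + N) (qC ^+ k * (Q / qC ^+ N)) / (1 + qC ^+ k * (Q / qC ^+ N)) - N%:R)
    @[N --> \oo] --> - ell qC Q.
Proof.
have [L L0 qL] := cvg_qfact.
have J : jacobi_sum qC Q N @[N --> \oo] --> L^-1%:C%C * theta qC Q.
  rewrite (theta_gser _ Q0) mulrDr; under eq_fun do rewrite jacobi_sumE.
  by apply: cvgD; exact: cvg_S.
have J' : jacobi_sum' qC Q N @[N --> \oo] --> L^-1%:C%C * (Q * derive1 (theta qC) Q).
  rewrite (derive_theta q01 Q0) -/qC.
  have -> : Q * (gser' q 0 Q - qC / Q ^+ 2 * gser' q 1 (qC / Q)) =
     Q * gser' q 0 Q - qC / Q * gser' q 1 (qC / Q).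
    by move: (gser' _ _ _) (gser' _ _ _) => u v; field.
  rewrite mulrBr; under eq_fun do rewrite jacobi_sum_derivE.
  by apply: cvgB; exact: cvg_S'.
have nz k N : 1 + qC ^+ k * (Q / qC ^+ N) != 0.
  have -> : 1 + qC ^+ k * (Q / qC ^+ N) = ray Q (q ^+ k / q ^+ N).
    by rewrite /ray fmorph_div !rmorphXn mulrA mulrAC.
  by rewrite ray_neq0 // divr_ge0 // exprn_ge0 // ltW.
have [c1 c10 lb1] := ray_lower_bound slitQ.
have slitV : ~~ (Q^-1 <= 0) by rewrite invr_le0.
have [c2 c20 lb2] := ray_lower_bound slitV.
have [d d0 Jd] : exists2 d : R, 0 < d & forall N, d <= cabs (jacobi_sum qC Q N).
  have b1 k : c1 <= cabs (1 + Q * qC ^+ k).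
    have p0 : 0 <= q ^+ k by rewrite exprn_ge0 // ltW.
    have -> : 1 + Q * qC ^+ k = ray Q (q ^+ k) by rewrite /ray rmorphXn mulrC.
    apply: le_trans (lb1 _ p0).
    by rewrite ler_peMr ?(ltW c10) // lerDl.
  have b2 k : c2 <= cabs (1 + (qC / Q) * qC ^+ k).
    have p0 : 0 <= q ^+ k.+1 by rewrite exprn_ge0 // ltW.
    have -> : 1 + qC / Q * qC ^+ k = ray Q^-1 (q ^+ k.+1).
      by rewrite /ray rmorphXn exprS mulrAC.
    apply: le_trans (lb2 _ p0).
    by rewrite ler_peMr ?(ltW c20) // lerDl.
  exists (expR (- (cabs Q / (c1 * (1 - q)))) * expR (- (cabs (qC / Q) / (c2 * (1 - q))))).
    by rewrite mulr_gt0 ?expR_gt0.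
  move=> N; rewrite jacobi_product //.
  have -> : \prod_(k < N) (1 + Q^-1 * qC ^+ k.+1) = \prod_(k < N) (1 + (qC / Q) * qC ^+ k).
    by apply: eq_bigr => k _; rewrite exprS mulrA [Q^-1 * _]mulrC.
  by rewrite [leRHS]Normc.normcM; apply: ler_pM; rewrite ?expR_ge0 //; apply: prod_lower_bound.
have Jn0 N : jacobi_sum qC Q N != 0 by rewrite -cabs_gt0 (lt_le_trans d0).
have Ln0 : L^-1%:C%C != 0 :> C by rewrite fmorph_eq0 invr_eq0 gt_eqF.
have lim_neq0 : L^-1%:C%C * theta qC Q != 0.
  rewrite -cabs_gt0; apply: (lt_le_trans d0); rewrite -lerN2.
  have cJ : - cabs (jacobi_sum qC Q N) @[N --> \oo] --> - cabs (L^-1%:C%C * theta qC Q).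
    by apply: cvgN; apply: cvg_cabs; exact: J.
  by apply: (cvg_le_const cJ); apply: nearW => N; rewrite lerN2.
have -> : - ell qC Q =
    L^-1%:C%C * (Q * derive1 (theta qC) Q) / (L^-1%:C%C * theta qC Q).
  rewrite /ell; move: lim_neq0; rewrite mulf_eq0 negb_or => /andP[_ t0].
  move: t0 Ln0; move: (theta qC Q) (derive1 _ Q) (L^-1)%:C%C => u v w u0 w0.
  by field; rewrite u0 w0.
have -> : (fun N => \sum_(k < N + N) (qC ^+ k * (Q / qC ^+ N)) / (1 + qC ^+ k * (Q / qC ^+ N))
    - N%:R) = (fun N => jacobi_sum' qC Q N / jacobi_sum qC Q N).
  apply/funext => N; rewrite (@jacobi_log_deriv _ qC qC_aperiodic Q N qC0 Q0); last first.
    by move=> k; exact: nz.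
  by rewrite mulrAC divff // mul1r.
by apply: cvgM; [exact: J'|apply: cvgV; [exact: lim_neq0|exact: J]].
Qed.

End JacobiLimit.

(** * The limit of the q-logarithm and of the whole expression *)

Section EllLimit.
Variable R : realType.
Local Notation C := R[i].
Local Notation cabs := (@Normc.normc R).

Lemma Log_scale (r : R) (z : C) : 0 < r -> z != 0 ->
  Log (r%:C%C * z) = (ln r)%:C%C + Log z.
Proof.
move=> r0 z0; have z1 : 0 < cabs z by rewrite cabs_gt0.
have rz : cabs (r%:C%C * z) = r * cabs z by rewrite Normc.normcM cabs_real gtr0_norm.
have arg : Arg (r%:C%C * z) = Arg z.
  rewrite /Arg Re_realM Im_realM !normCE rz pmulr_rge0 //.
  change (complex.Re (r * cabs z)%:C%C) with (r * cabs z).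
  change (complex.Re (cabs z)%:C%C) with (cabs z).
  by rewrite invfM mulrACA divff ?gt_eqF // mul1r.
apply/eqP; rewrite eq_complex /Log arg !normCE rz /= add0r eqxx andbT.
by apply/eqP; rewrite -[RHS]/(ln r + ln (cabs z)) -lnM.
Qed.

Lemma Log1 : Log (1 : C) = 0.
Proof.
apply/eqP; rewrite eq_complex /Log /Arg normCE Normc.normc1 /= ln1 divr1 acos1 lexx.
by rewrite !eqxx.
Qed.

(** For fixed t compare the Riemann sum of the slope over s = - t N, ..., t N with
    the increment of the logarithm, and let N tend to infinity. The increment is
    t N + Log (q^N + Q) - Log (1 + q^N Q), and the term t N is the one that the
    finite logarithmic derivative of theta subtracts. *)
Lemma ell_bound (Q : C) : ~~ (Q <= 0) -> exists K : R, forall t, 0 < t ->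
  cabs (Log Q - - t%:C%C * ell (qpow t 1) Q) <= t * K.
Proof.
move=> sQ; have [c c0 lb] := ray_lower_bound sQ.
exists (2 * (cabs Q / c ^+ 2)) => t t0.
set q := expR (- t).
have q01 : 0 < q < 1 by rewrite expR_gt0 expR_lt1 oppr_lt0.
have -> : qpow t 1 = q%:C%C by rewrite qpowE mulr1.
have /andP[q0 q1] := q01.
have qX n : expR (- (t *+ n)) = q ^+ n by rewrite -mulNrn -mulr_natl expRM_natl.
have qN : (q ^+ N)%:C%C @[N --> \oo] --> (0 : R)%:C%C.
  by apply: cvg_real_complex; apply: cvg_expr; rewrite gtr0_norm.
have T := cvg_log_deriv_theta q01 sQ.
set f := fun N => _ in T.
have l1 : Log ((q ^+ N)%:C%C + Q) @[N --> \oo] --> Log Q.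
  apply: cvg_Log; first by rewrite -slitP.
  have {2}-> : Q = 0%:C%C + Q by rewrite add0r.
  by apply: cvgD; [exact: qN|exact: cvg_cst].
have l2 : Log (1 + (q ^+ N)%:C%C * Q) @[N --> \oo] --> Log (1 : C).
  apply: cvg_Log; first by rewrite Normc.normc1 /= addr_gt0.
  have {2}-> : 1 = 1 + 0%:C%C * Q by rewrite mul0r addr0.
  apply: cvgD; first exact: cvg_cst.
  by apply: cvgM; [exact: qN|exact: cvg_cst].
have l3 : t%:C%C * f N @[N --> \oo] --> t%:C%C * (- ell q%:C%C Q).
  by apply: cvgM; [exact: cvg_cst|exact: T].
have lhs : Log ((q ^+ N)%:C%C + Q) - Log (1 + (q ^+ N)%:C%C * Q) - t%:C%C * f N
    @[N --> \oo] --> Log Q - Log 1 - t%:C%C * (- ell q%:C%C Q).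
  exact: (cvgB (cvgB l1 l2) l3).
have -> : Log Q - - t%:C%C * ell q%:C%C Q = Log Q - Log 1 - t%:C%C * (- ell q%:C%C Q).
  by rewrite Log1; ring.
apply: (cvg_le_const (cvg_cabs lhs)); apply: nearW => N.
have := Log_riemann_sum sQ (- (t *+ N)) (N + N) c0 t0 lb.
congr (cabs _ <= _).
have qNu : q ^+ N != 0 by rewrite expf_neq0 // gt_eqF.
have qNC : (q ^+ N)%:C%C != 0 :> C by rewrite fmorph_eq0.
rewrite mulrnDr addKr /raylog opprK.
have -> : ray Q (expR (t *+ N)) = ((q ^+ N)^-1)%:C%C * ((q ^+ N)%:C%C + Q).
  rewrite /ray -[expR _]invrK -expRN qX fmorphV mulrDr mulVf //.
have -> : ray Q (expR (- (t *+ N))) = 1 + (q ^+ N)%:C%C * Q by rewrite /ray qX.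
have lnqN : ln (q ^+ N)^-1 = t *+ N by rewrite -qX -expRN opprK expRK.
rewrite Log_scale ?invr_gt0 ?exprn_gt0 //; last first.
  apply: contraNneq sQ => /eqP; rewrite addrC addr_eq0 => /eqP ->.
  by rewrite oppr_le0 ler0c exprn_ge0 // ltW.
rewrite lnqN.
have -> : \sum_(k < N + N) slope Q (- (t *+ N) + t *+ k) = f N + N%:R.
  rewrite /f subrK; apply: eq_bigr => k _; rewrite /slope /raylog /ray.
  have -> : expR (- (- (t *+ N) + t *+ k)) = q ^+ k / q ^+ N.
    by rewrite opprD opprK addrC expRD qX -[expR (t *+ N)]invrK -expRN qX.
  by rewrite fmorph_div !rmorphXn [_ / _ * Q]mulrAC -(mulrA _ Q).
have -> : (t *+ N)%:C%C = t%:C%C * N%:R :> C by rewrite raddfMn mulr_natr.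
by ring.
Qed.

Lemma cvg_ell (Q : C) : ~~ (Q <= 0) ->
  - t%:C%C * ell (qpow t 1) Q @[t --> (0 : R)^'+] --> Log Q.
Proof.
move=> /ell_bound[K bK].
apply: (cvgC_bound (g := fun t => t * K)).
  by near=> t; apply: bK; near: t; exact: nbhs_right_gt.
have h : t * K @[t --> (0 : R)^'+] --> 0 * K.
  by apply: cvgM; [exact: cvg_at_right_filter|exact: cvg_cst].
by rewrite mul0r in h.
Unshelve. all: by end_near. Qed.

End EllLimit.

Theorem lemma6p1 (R : realType) (Q : R[i])
    (Q_gt0 : 0 < `|Q|) (Q_lt1 : `|Q| < 1) (Q_slit : ~~ (Q <= 0))
    (k : nat) (k_lt4 : (k < 4)%N) :
  (let q := qpow t 1 in
   let P := qH t in
   powH P (ell q Q) *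
   hsum (fun d =>
     Q ^+ d *: ((\prod_(1 <= i < 5) qpoch (qpow t (i%:R / 5) *: P) q d)
                / qpoch (q *: P) q d ^+ 4)))`_k
    @[t --> (0 : R)^'+]
  -->
  (expH (Log Q) *
   hsum (fun d =>
     Q ^+ d *: ((\prod_(1 <= i < 5) poch (H + (i%:R / 5)%:A) d)
                / poch (H + 1) d ^+ 4)))`_k.
Proof.
have Q1 : Normc.normc Q < 1 by move: Q_lt1; rewrite normCE -(rmorph1 (real_complex R)) ltcR.
exact: (cvgHM (cvg_powH_qH (cvg_ell Q_slit)) (cvg_hypergeometric Q1) k_lt4).
Qed.
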